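(* Let $\vartheta_{\boldsymbol{P}}=(\vartheta,\boldsymbol{P})$ be a primitive and compatible random substitution on a finite alphabet $\mathcal{A}$ with Perron--Frobenius eigenvalue $\lambda$ and corresponding frequency measure $\mu_{\boldsymbol{P}}$. Then for all $q\ge 0$: 1. If $\vartheta_{\boldsymbol{P}}$ satisfies the disjoint set condition, then $\tau_{\mu_{\boldsymbol{P}}}(q)=\frac{1}{\lambda-1}\varphi_1(q)$. 2. If $\vartheta_{\boldsymbol{P}}$ satisfies the identical set condition and has identical production probabilities, then $\tau_{\mu_{\boldsymbol{P}}}(q)=\frac{1}{\lambda}\varphi_1(q)$.
   Context: Random substitutions. Let $\mathcal{A}$ be a finite alphabet and $\mathcal{A}^+$ the set of non-empty finite words over $\mathcal{A}$; $|v|$ is the length of $v$ and $|v|_u$ the number of (possibly overlapping) occurrences of $u$ as a subword of $v$. A random substitution $\vartheta_{\boldsymbol{P}}=(\vartheta,\boldsymbol{P})$ consists of a set-valued substitution $\vartheta$ assigning to each letter $a$ a non-empty finite set $\vartheta(a)\subset\mathcal{A}^+$, together with, for each letter $a$, a probability vector on $\vartheta(a)$ with all entries strictly positive; $\mathbb{P}[\vartheta_{\boldsymbol{P}}(a)=s]$ denotes the probability of $s\in\vartheta(a)$. It acts on words by replacing each letter independently and concatenating; $\vartheta_{\boldsymbol{P}}^k(u)$ is the $k$-th step of the Markov chain on $\mathcal{A}^+$ started at $u$ (fresh independent choices at each step), and $\vartheta^k(u)$ is the set of words $v$ with $\mathbb{P}[\vartheta_{\boldsymbol{P}}^k(u)=v]>0$.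 The substitution matrix is $M_{b,a}=\mathbb{E}[|\vartheta_{\boldsymbol{P}}(a)|_b]$. $\vartheta_{\boldsymbol{P}}$ is primitive if some power of $M$ has all entries positive and the Perron--Frobenius eigenvalue $\lambda$ of $M$ satisfies $\lambda>1$. $\boldsymbol{R}=(R_a)_{a\in\mathcal{A}}$ is the positive right eigenvector, $M\boldsymbol{R}=\lambda\boldsymbol{R}$, with $\sum_aR_a=1$. $\vartheta_{\boldsymbol{P}}$ is compatible if for all $a,b\in\mathcal{A}$ and $u,v\in\vartheta(a)$, $|u|_b=|v|_b$. Disjoint set condition: for all $a\in\mathcal{A}$, $k\in\mathbb{N}$ and $u,v\in\vartheta(a)$ with $u\ne v$, $\vartheta^k(u)\cap\vartheta^k(v)=\varnothing$. Identical set condition: for all $a\in\mathcal{A}$, $k\in\mathbb{N}$ and $u,v\in\vartheta(a)$, $\vartheta^k(u)=\vartheta^k(v)$. Identical production probabilities: for all $a\in\mathcal{A}$, all integers $k\ge2$, all $v\in\vartheta^k(a)$ and all $u_1,u_2\in\vartheta(a)$, $\mathbb{P}[\vartheta_{\boldsymbol{P}}^{k-1}(u_1)=v]=\mathbb{P}[\vartheta_{\boldsymbol{P}}^{k-1}(u_2)=v]$. A word is legal if it is a subword of some element of $\vartheta^k(a)$ for some $k\in\mathbb{N}$, $a\in\mathcal{A}$; $\mathcal{L}_\vartheta^n$ is the set of legal words of length $n$. The subshift $X_\vartheta\subset\mathcal{A}^{\mathbb{Z}}$ is the set of bi-infinite sequences all of whose finite subwords are legal. For legal $v$, $[v]=\{x\in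 X_\vartheta:x_i=v_i,\ 1\le i\le|v|\}$. The frequency measure $\mu_{\boldsymbol{P}}$ is the unique shift-invariant Borel probability measure on $X_\vartheta$ with $\mu_{\boldsymbol{P}}([v])=\lim_{k\to\infty}\mathbb{E}[|\vartheta_{\boldsymbol{P}}^k(a)|_v]/\mathbb{E}[|\vartheta_{\boldsymbol{P}}^k(a)|]$ for every legal $v$ (the limit exists and does not depend on $a\in\mathcal{A}$, by primitivity). For $q\in\mathbb{R}$, the $L^q$-spectrum is $\tau_{\mu_{\boldsymbol{P}}}(q)=\liminf_{n\to\infty}-\frac1n\log\sum_{u\in\mathcal{L}_\vartheta^n}\mu_{\boldsymbol{P}}([u])^q$, and $$\varphi_1(q)=-\sum_{a\in\mathcal{A}}R_a\log\Big(\sum_{s\in\vartheta(a)}\mathbb{P}[\vartheta_{\boldsymbol{P}}(a)=s]^q\Big).$$ *)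

(* Defs.v *)
From HB Require Import structures.
From mathcomp Require Import all_boot all_order all_algebra finmap complex.
From mathcomp Require Import all_classical all_reals all_analysis.

Set Implicit Arguments.
Unset Strict Implicit.
Unset Printing Implicit Defensive.

Import Order.TTheory GRing.Theory Num.Theory.
Import numFieldNormedType.Exports.

Local Open Scope classical_set_scope.
Local Open Scope ring_scope.

(* The base point only records that the alphabet is not empty: measurable
   types, hence the measurable space of bi-infinite sequences, are pointed in
   MathComp-Analysis. *)
#[short(type="alphabetType")]
HB.structure Definition Alphabet := {A of Finite A & isPointed A}.

Section RandomSubstitution.
Variables (R : realType) (A : alphabetType).

(* [prob a s] is P[theta_P(a) = s]. *)
Record random_substitution := RandomSubstitution {
  realisations : A -> {fset seq A} ;
  prob : A -> seq A -> R ;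
  realisations_neq0 : forall a, realisations a != fset0 ;
  nil_notin_realisations : forall a, [::] \notin realisations a ;
  prob_gt0 : forall a s, s \in realisations a -> 0 < prob a s ;
  prob_eq0 : forall a s, s \notin realisations a -> prob a s = 0 ;
  prob_sum1 : forall a, \sum_(s <- realisations a) prob a s = 1 }.

(* A finitely supported law on words, as a list of weighted outcomes; the same
   word may occur several times, its probability being the total weight. *)
Definition word_law := seq (seq A * R).

Definition Pr (d : word_law) (v : seq A) : R := \sum_(x <- d | x.1 == v) x.2.

Definition Ex (d : word_law) (f : seq A -> R) : R := \sum_(x <- d) x.2 * f x.1.

Variable th : random_substitution.

(* The law of theta_P(u): the letters of u are replaced independently, so that
   the weights multiply, and the images are concatenated. *)
Fixpoint law1 (u : seq A) : word_law :=
  if u is a :: u' then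
    [seq (s ++ x.1, prob th a s * x.2) | s <- realisations th a, x <- law1 u']
  else [:: ([::], 1)].

(* The law of theta_P^k(u), the k-th step of the Markov chain. *)
Fixpoint law (k : nat) (u : seq A) : word_law :=
  if k is k'.+1 then
    [seq (y.1, x.2 * y.2) | x <- law k' u, y <- law1 x.1]
  else [:: (u, 1)].

Definition theta_iter (k : nat) (u : seq A) : set (seq A) :=
  [set v | 0 < Pr (law k u) v].

(* |v|_u for a non-empty u, counting the positions at which u occurs. *)
Definition occ (u v : seq A) : nat :=
  count (fun i => prefix u (drop i v)) (iota 0 (size v)).

(* Rows and columns are indexed by the letters through enum_val. *)
Definition subst_mx : 'M[R]_#|A| :=
  \matrix_(i, j) Ex (law1 [:: enum_val j])
                    (fun v => (occ [:: enum_val i] v)%:R).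

(* An eigenvalue of M that is at least the modulus of every complex one. *)
Definition perron_eigenvalue n (M : 'M[R]_n) (lambda : R) : Prop :=
  eigenvalue M lambda /\
  forall z : R[i], eigenvalue (map_mx (real_complex R) M) z ->
    `|z| <= real_complex R lambda.

Definition perron_vector n (M : 'M[R]_n) (lambda : R) (r : 'cV[R]_n) : Prop :=
  [/\ M *m r = lambda *: r, forall i, 0 < r i 0 & \sum_i r i 0 = 1].

Definition primitive_subst : Prop :=
  (exists2 k, (0 < k)%N & forall i j, 0 < (subst_mx ^+ k) i j) /\
  (exists2 lambda, perron_eigenvalue subst_mx lambda & 1 < lambda).

Definition compatible_subst : Prop :=
  forall (a b : A) (u v : seq A),
    u \in realisations th a -> v \in realisations th a ->
    occ [:: b] u = occ [:: b] v.

(* Below, k ranges over the positive integers: for k = 0 the disjoint set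
   condition is void, whereas the identical set condition would force every
   realisations th a to be a singleton. *)
Definition disjoint_set_condition : Prop :=
  forall (a : A) (k : nat) (u v : seq A), (0 < k)%N ->
    u \in realisations th a -> v \in realisations th a -> u != v ->
    theta_iter k u `&` theta_iter k v = set0.

Definition identical_set_condition : Prop :=
  forall (a : A) (k : nat) (u v : seq A), (0 < k)%N ->
    u \in realisations th a -> v \in realisations th a ->
    theta_iter k u = theta_iter k v.

Definition identical_production_probabilities : Prop :=
  forall (a : A) (k : nat) (v u1 u2 : seq A), (2 <= k)%N ->
    theta_iter k [:: a] v ->
    u1 \in realisations th a -> u2 \in realisations th a ->
    Pr (law k.-1 u1) v = Pr (law k.-1 u2) v.

Definition legal (u : seq A) : Prop :=
  exists (k : nat) (a : A) (w : seq A),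
    [/\ (0 < k)%N, theta_iter k [:: a] w & infix u w].

(* A^Z with the product of the discrete topologies, and its Borel sets. *)
Definition bi_infinite : topologicalType :=
  prod_topology (fun _ : int => discrete_topology A).

Definition bi_infinite_borel : measurableType _ :=
  g_sigma_algebraType (@open bi_infinite).

Definition subword (x : int -> A) (i : int) (n : nat) : seq A :=
  mkseq (fun j => x (i + j%:Z)) n.

Definition left_shift (x : int -> A) : int -> A := fun i => x (i + 1).

Definition subshift : set (int -> A) :=
  [set x | forall i n, legal (subword x i n)].

Definition cylinder (v : seq A) : set (int -> A) :=
  [set x | subshift x /\ subword x 1 (size v) = v].

(* A Borel probability measure on the (closed) subshift is regarded as a Borel
   probability measure on A^Z that gives the subshift mass 1. *)
Definition frequency_measure (mu : probability bi_infinite_borel R) : Prop :=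
  [/\ mu subshift = 1%E,
      forall E : set bi_infinite_borel, measurable E ->
        mu (left_shift @^-1` E) = mu E &
      forall v, legal v -> forall a : A,
        (fun k => Ex (law k [:: a]) (fun w => (occ v w)%:R) /
                  Ex (law k [:: a]) (fun w => (size w)%:R)) @ \oo
          --> fine (mu (cylinder v))].

Definition Lq_spectrum (mu : probability bi_infinite_borel R) (q : R) : \bar R :=
  limn_einf (fun n =>
    (- (n%:R^-1 * ln (\sum_(u : n.-tuple A | `[< legal u >])
                         fine (mu (cylinder u)) `^ q)))%:E).

Definition phi1 (r : 'cV[R]_#|A|) (q : R) : R :=
  - \sum_(a : A) r (enum_rank a) 0 *
      ln (\sum_(s <- realisations th a) prob th a s `^ q).

End RandomSubstitution.

(* Main.v *)
(* Write Z_k(v) for the sum of the P[theta^k(v) = w]^q over the outcomes w, and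
   phi_k for - sum_a R_a log Z_k(a). By compatibility Z_k is multiplicative on
   words, and legal words v have letter frequencies uniformly close to R, so that
   log Z_k(v) = - |v| phi_k + o(|v|) and |theta^k(v)| = lambda^k |v| + o(|v|).

   A legal word u of length n occurs inside theta^k(v) for some legal v of length
   m close to n / lambda^k. Hence mu[u] is at most the sum, over these v and over
   the bounded offset j, of the probability that u is read at position j of
   theta^k(v); conversely mu[u] is at least a constant times mu[v] times the
   probability that theta^k(v) starts with u, and some v has mu[v] >= |A|^-m.
   There are O(|A|^m) pairs (v, j), and truncating theta^k(v) to n letters merges
   at most |A|^o(n) outcomes, so all error factors are exp(O(n / lambda^k) + o(n))
   and - log(sum_u mu[u]^q) / n is within O(lambda^-k) + o(1) of phi_k / lambda^k.

   The disjoint set condition gives phi_(k+1) = phi_1 + lambda phi_k, and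
   identical production probabilities give phi_(k+1) = lambda phi_k, so that
   phi_k / lambda^k tends to phi_1 / (lambda - 1), respectively equals
   phi_1 / lambda. *)

Require Import Defs.
From HB Require Import structures.
From mathcomp Require Import all_boot all_order all_algebra finmap complex.
From mathcomp Require Import all_classical all_reals all_analysis.
From mathcomp Require Import ring lra zify.

Set Implicit Arguments.
Unset Strict Implicit.
Unset Printing Implicit Defensive.

Import Order.TTheory GRing.Theory Num.Theory.
Import numFieldNormedType.Exports.

Local Open Scope classical_set_scope.
Local Open Scope ring_scope.

(** * Expectations under finitely supported laws *)

Section Expectation.
Variables (R : realType) (A : alphabetType).
Implicit Types (d : word_law R A) (f g : seq A -> R) (c : R).

Lemma PrE d v : Pr d v = Ex d (fun w => (w == v)%:R).
Proof.
rewrite /Pr /Ex big_mkcond; apply: eq_bigr => x _.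
by case: eqP; rewrite ?mulr1 ?mulr0.
Qed.

Lemma eq_Ex d f g : {in unzip1 d, f =1 g} -> Ex d f = Ex d g.
Proof.
move=> fg; apply: eq_big_seq => x xd.
by rewrite fg //; apply: map_f.
Qed.

Lemma Ex_sum I (s : seq I) (P : pred I) d (F : I -> seq A -> R) :
  Ex d (fun w => \sum_(i <- s | P i) F i w) = \sum_(i <- s | P i) Ex d (F i).
Proof.
rewrite /Ex exchange_big /=; apply: eq_bigr => x _.
by rewrite mulr_sumr.
Qed.

Lemma ExD d f g : Ex d (fun w => f w + g w) = Ex d f + Ex d g.
Proof. by rewrite /Ex -big_split /=; apply: eq_bigr => x _; rewrite mulrDr. Qed.

Lemma ExZ d c f : Ex d (fun w => c * f w) = c * Ex d f.
Proof. by rewrite /Ex mulr_sumr; apply: eq_bigr => x _; rewrite mulrCA. Qed.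

Lemma ExZr d c f : Ex d (fun w => f w * c) = Ex d f * c.
Proof. by rewrite /Ex mulr_suml; apply: eq_bigr => x _; rewrite mulrA. Qed.

Lemma Ex_exchange d1 d2 (F : seq A -> seq A -> R) :
  Ex d1 (fun x => Ex d2 (F x)) = Ex d2 (fun y => Ex d1 (F^~ y)).
Proof.
rewrite /Ex; under eq_bigr do rewrite mulr_sumr.
rewrite exchange_big /=; apply: eq_bigr => y _.
by rewrite mulr_sumr; apply: eq_bigr => x _; rewrite mulrCA.
Qed.

(** Zero weights are excluded, so that the words listed in a law are exactly those of positive
    probability ([Pr_gt0]). *)
Definition pos_law d := forall x, x \in d -> 0 < x.2.

Lemma le_Ex d f g : pos_law d ->
  (forall w, w \in unzip1 d -> f w <= g w) -> Ex d f <= Ex d g.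
Proof.
move=> d0 fg; rewrite /Ex !big_seq; apply: ler_sum => x xd.
by rewrite ler_wpM2l ?(ltW (d0 _ _)) // fg //; apply: map_f.
Qed.

Lemma Ex_ge0 d f : pos_law d -> (forall w, 0 <= f w) -> 0 <= Ex d f.
Proof.
move=> d0 f0; rewrite /Ex big_seq sumr_ge0 // => x xd.
by rewrite mulr_ge0 // ltW // d0.
Qed.

Lemma Ex_gt0P d f : pos_law d -> (forall w, 0 <= f w) ->
  reflect (exists2 w, w \in unzip1 d & 0 < f w) (0 < Ex d f).
Proof.
move=> d0 f0; have tge0 x : x \in d -> 0 <= x.2 * f x.1.
  by move=> xd; rewrite mulr_ge0 // ltW // d0.
rewrite lt_def Ex_ge0 // andbT /Ex big_seq_cond psumr_neq0; last first.
  by move=> x /andP[xd _]; apply: tge0.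
apply: (iffP hasP) => [[x xd]|[w /mapP[x xd ->]] fx].
  rewrite xd /= => h; exists x.1; first exact: map_f.
  by move: h; rewrite pmulr_rgt0 // d0.
by exists x => //; rewrite xd /= mulr_gt0 // d0.
Qed.

Lemma Pr_ge0 d v : pos_law d -> 0 <= Pr d v.
Proof. by move=> d0; rewrite PrE; apply: Ex_ge0. Qed.

Lemma Pr_gt0 d v : pos_law d -> (0 < Pr d v) = (v \in unzip1 d).
Proof.
move=> d0; rewrite PrE; apply/Ex_gt0P/idP => // [[w wd]|vd].
  by case: eqP => [<-//|_]; rewrite ltxx.
by exists v => //; rewrite eqxx.
Qed.

End Expectation.

(** * The k-step law on words *)

Section MarkovChain.
Variables (R : realType) (A : alphabetType) (th : random_substitution R A).
Implicit Types (u v w x y : seq A) (f g : seq A -> R) (c : R) (a b : A) (k : nat).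

Lemma Ex_law1_nil f : Ex (law1 th [::]) f = f [::].
Proof. by rewrite /Ex /= big_seq1 mul1r. Qed.

Lemma Ex_law1_cons a u f : Ex (law1 th (a :: u)) f =
  \sum_(s <- realisations th a) prob th a s * Ex (law1 th u) (fun y => f (s ++ y)).
Proof.
rewrite /Ex /= big_allpairs_dep /=; apply: eq_bigr => s _.
by rewrite mulr_sumr; apply: eq_bigr => x _; rewrite mulrA.
Qed.

Lemma Ex_law1_seq1 a f : Ex (law1 th [:: a]) f =
  \sum_(s <- realisations th a) prob th a s * f s.
Proof.
rewrite Ex_law1_cons; apply: eq_bigr => s _.
by rewrite Ex_law1_nil cats0.
Qed.

Lemma Ex_law1_cat u v f : Ex (law1 th (u ++ v)) f =
  Ex (law1 th u) (fun x => Ex (law1 th v) (fun y => f (x ++ y))).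
Proof.
elim: u f => [|a u IH] f; first by rewrite Ex_law1_nil.
rewrite /= !Ex_law1_cons; apply: eq_bigr => s _.
congr (_ * _); rewrite IH; apply: eq_bigr => x _; congr (_ * _).
by apply: eq_bigr => y _; rewrite catA.
Qed.

Lemma Ex_law0 u f : Ex (law th 0 u) f = f u.
Proof. by rewrite /Ex /= big_seq1 mul1r. Qed.

Lemma Ex_lawS k u f :
  Ex (law th k.+1 u) f = Ex (law th k u) (fun x => Ex (law1 th x) f).
Proof.
rewrite /Ex /= big_allpairs_dep /=; apply: eq_bigr => x _.
by rewrite mulr_sumr; apply: eq_bigr => y _; rewrite mulrA.
Qed.

(** Each step treats the letters independently, so the images of [u] and [v] remain independent at
    every step; finite sums may be exchanged. *)
Lemma Ex_law_cat k u v f : Ex (law th k (u ++ v)) f =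
  Ex (law th k u) (fun x => Ex (law th k v) (fun y => f (x ++ y))).
Proof.
elim: k f => [|k IH] f; first by rewrite !Ex_law0.
rewrite !Ex_lawS IH; apply: eq_bigr => x _; congr (_ * _).
rewrite (@eq_Ex _ _ _ _ (fun y => Ex (law1 th x.1) (fun x' =>
  Ex (law1 th y) (fun y' => f (x' ++ y'))))); last first.
  by move=> y _; rewrite Ex_law1_cat.
by rewrite Ex_exchange; apply: eq_bigr => y _; rewrite Ex_lawS.
Qed.

Lemma Ex_law_add j k u f :
  Ex (law th (j + k) u) f = Ex (law th j u) (fun x => Ex (law th k x) f).
Proof.
elim: k f => [|k IH] f.
  by rewrite addn0; apply: eq_bigr => x _; rewrite Ex_law0.
rewrite addnS Ex_lawS IH; apply: eq_bigr => x _.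
by rewrite Ex_lawS.
Qed.

Lemma Ex_law_nil k f : Ex (law th k [::]) f = f [::].
Proof. by elim: k f => [|k IH] f; rewrite ?Ex_law0 // Ex_lawS IH Ex_law1_nil. Qed.

Lemma law1_pos u : pos_law (law1 th u).
Proof.
elim: u => [|a u IH] x /=; first by rewrite inE => /eqP ->.
case/allpairsP => -[s y] /= [sa yu ->] /=.
by rewrite mulr_gt0 ?prob_gt0 //; apply: IH.
Qed.

Lemma law_pos k u : pos_law (law th k u).
Proof.
elim: k u => [|k IH] u x /=; first by rewrite inE => /eqP ->.
by case/allpairsPdep => y [z] [yu zy ->] /=; rewrite mulr_gt0 //; [apply: IH yu|apply: law1_pos zy].
Qed.

Lemma Ex_law1_cst u c : Ex (law1 th u) (fun=> c) = c.
Proof.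
elim: u => [|a u IH]; first by rewrite Ex_law1_nil.
by rewrite Ex_law1_cons IH -mulr_suml prob_sum1 mul1r.
Qed.

Lemma Ex_law_cst k u c : Ex (law th k u) (fun=> c) = c.
Proof.
elim: k => [|k IH]; first by rewrite Ex_law0.
by rewrite Ex_lawS -[RHS]IH; apply: eq_bigr => x _; rewrite Ex_law1_cst.
Qed.

(** The list form of [theta_iter], with decidable membership; [reachP] relates the two. *)
Definition reach k u : seq (seq A) := unzip1 (law th k u).

Lemma reachP k u w : reflect (0 < Pr (law th k u) w) (w \in reach k u).
Proof. rewrite Pr_gt0; [exact: idP|exact: law_pos]. Qed.

Lemma reach_catP k u v w : reflect
  (exists x y, [/\ x \in reach k u, y \in reach k v & w = x ++ y])
  (w \in reach k (u ++ v)).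
Proof.
apply: (iffP (reachP _ _ _)); rewrite PrE Ex_law_cat.
  case/Ex_gt0P => [|x|x xu]; [exact: law_pos|by apply: Ex_ge0 => //; exact: law_pos|].
  case/Ex_gt0P => [|//|y yv]; first exact: law_pos.
  by case: eqP => [<- _|_]; rewrite ?ltxx //; exists x, y.
case=> x [y] [xu yv ->].
apply/Ex_gt0P => [|z|]; [exact: law_pos|by apply: Ex_ge0 => //; exact: law_pos|].
exists x => //; apply/Ex_gt0P => //; first exact: law_pos.
by exists y => //; rewrite eqxx.
Qed.

Lemma reach_addP j k u w : reflect
  (exists2 x, x \in reach j u & w \in reach k x) (w \in reach (j + k) u).
Proof.
apply: (iffP (reachP _ _ _)); rewrite PrE Ex_law_add.
  case/Ex_gt0P => [|x|x xu]; [exact: law_pos|by apply: Ex_ge0 => //; exact: law_pos|].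
  by rewrite -PrE => /reachP wx; exists x.
case=> x xu /reachP; rewrite PrE => wx.
apply/Ex_gt0P => [|z|]; [exact: law_pos|by apply: Ex_ge0 => //; exact: law_pos|].
by exists x.
Qed.

Lemma reach_cat k u v x y :
  x \in reach k u -> y \in reach k v -> x ++ y \in reach k (u ++ v).
Proof. by move=> xu yv; apply/reach_catP; exists x, y. Qed.

Lemma reach_nil k w : w \in reach k [::] -> w = [::].
Proof.
move=> /reachP; rewrite PrE Ex_law_nil.
by case: eqP => [->|]; rewrite ?ltxx.
Qed.

Lemma reach0 u w : w \in reach 0 u -> w = u.
Proof. by rewrite /reach /= inE => /eqP. Qed.

Lemma reach1_seq1 a w : (w \in reach 1 [:: a]) = (w \in realisations th a).
Proof.
apply/reachP/idP; rewrite PrE Ex_lawS Ex_law0 Ex_law1_seq1.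
  apply: contraTT => wa; rewrite -leNgt big_seq big1 // => s sa.
  by case: eqP => [sw|]; rewrite ?mulr0 //; move: wa; rewrite -sw sa.
move=> wa; rewrite (big_fsetD1 w) //= eqxx mulr1 ltr_pwDl ?prob_gt0 //.
rewrite big_seq sumr_ge0 // => s; rewrite !inE => /andP[_ sa].
by rewrite mulr_ge0 // ltW // prob_gt0.
Qed.

Lemma reach_ex k u : exists w, w \in reach k u.
Proof.
have : 0 < Ex (law th k u) (fun=> 1) by rewrite Ex_law_cst.
by case/Ex_gt0P => [|//|w wu _]; [exact: law_pos|exists w].
Qed.

Lemma Pr_law1 a s : Pr (law th 1 [:: a]) s = prob th a s.
Proof.
rewrite PrE Ex_lawS Ex_law0 Ex_law1_seq1.
have [sa|sa] := boolP (s \in realisations th a).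
  rewrite (big_fsetD1 s) //= eqxx mulr1 big_seq big1 ?addr0 // => t.
  by rewrite !inE => /andP[/negPf -> _]; rewrite mulr0.
rewrite prob_eq0 // big_seq big1 // => t ta.
by case: eqP sa => [<-|]; rewrite ?ta ?mulr0.
Qed.

End MarkovChain.

(** * Letter counts under compatibility *)

Lemma sum_count_mem_nat (A : finType) (F : A -> nat) (x : seq A) :
  (\sum_(a <- x) F a = \sum_a count_mem a x * F a)%N.
Proof.
elim: x => [|a x IH]; first by rewrite big_nil big1.
rewrite big_cons IH [in RHS](eq_bigr (fun b => (a == b) * F b + count_mem b x * F b)%N).
  rewrite big_split /=; congr (_ + _)%N; rewrite (bigD1 a) //= eqxx mul1n big1 ?addn0 // => b.
  by rewrite eq_sym => /negPf ->.
by move=> b _ /=; rewrite mulnDl.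
Qed.

Lemma sum_count_mem (R : pzRingType) (A : finType) (F : A -> R) (x : seq A) :
  \sum_(a <- x) F a = \sum_a (count_mem a x)%:R * F a.
Proof.
elim: x => [|a x IH]; first by rewrite big_nil big1 // => a _; rewrite mul0r.
rewrite big_cons IH [in RHS](eq_bigr (fun b => (a == b)%:R * F b + (count_mem b x)%:R * F b)).
  rewrite big_split /=; congr (_ + _); rewrite (bigD1 a) //= eqxx mul1r big1 ?addr0 // => b.
  by rewrite eq_sym => /negPf ->; rewrite mul0r.
by move=> b _ /=; rewrite natrD mulrDl.
Qed.

Lemma occ_cons (A : alphabetType) (u v : seq A) (a : A) :
  occ u (a :: v) = (prefix u (a :: v) + occ u v)%N.
Proof. by rewrite /occ /= -[1%N]/(1 + 0)%N iotaDl count_map. Qed.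

Lemma occ_nil (A : alphabetType) (u : seq A) : occ u [::] = 0%N.
Proof. by []. Qed.

Lemma occ_seq1 (A : alphabetType) (a : A) (v : seq A) :
  occ [:: a] v = count_mem a v.
Proof.
by elim: v => // b v IH; rewrite occ_cons IH /= prefix0s andbT eq_sym.
Qed.

Section Compatible.
Variables (R : realType) (A : alphabetType) (th : random_substitution R A).
Hypothesis compat : compatible_subst th.
Implicit Types (u v w x y : seq A) (f g : seq A -> R) (c : R) (a b : A) (k : nat).
Local Notation reach := (reach th).

Lemma realisation_ex a : exists s, s \in realisations th a.
Proof. exact/fset0Pn/realisations_neq0. Qed.

(* By compatibility, any other choice of a realisation gives the same count. *)
Definition letter_count a b : nat := count_mem b (xchoose (realisation_ex a)).

Lemma letter_countE a b s :
  s \in realisations th a -> count_mem b s = letter_count a b.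
Proof.
move=> sa; rewrite /letter_count -!occ_seq1.
by apply: (compat b sa); apply: (xchooseP (realisation_ex a)).
Qed.

(** The entry of the k-th power of the substitution matrix in row [b] and column [a] ([subst_mxXE]),
    kept as a natural number. *)
Fixpoint iter_count k a b : nat :=
  if k is k'.+1 then \sum_d iter_count k' a d * letter_count d b else a == b.

Lemma iter_countS k a b :
  iter_count k.+1 a b = (\sum_d iter_count k a d * letter_count d b)%N.
Proof. by []. Qed.

Lemma iter_count1 a b : iter_count 1 a b = letter_count a b.
Proof.
rewrite /= (bigD1 a) //= eqxx mul1n big1 ?addn0 // => d.
by rewrite eq_sym => /negPf ->.
Qed.

Lemma iter_count_add j k a b :
  iter_count (j + k) a b = (\sum_d iter_count j a d * iter_count k d b)%N.
Proof.
elim: k b => [|k IH] b.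
  rewrite addn0 (bigD1 b) //= eqxx muln1 big1 ?addn0 // => d /negPf ->.
  by rewrite muln0.
rewrite addnS iter_countS.
under eq_bigr do rewrite IH big_distrl /=.
rewrite exchange_big /=; apply: eq_bigr => d _.
by rewrite big_distrr /=; apply: eq_bigr => e _; rewrite mulnA.
Qed.

(** Under compatibility, the common length of all realisations of theta^k(a); [word_len] plays the
    same role for words ([size_reach]). *)
Definition iter_len k a : nat := \sum_b iter_count k a b.
Definition word_len k u : nat := \sum_(a <- u) iter_len k a.

Lemma count_reach1 u w b : w \in unzip1 (law1 th u) ->
  count_mem b w = (\sum_(a <- u) letter_count a b)%N.
Proof.
elim: u w => [|a u IH] w /=; first by rewrite inE big_nil => /eqP ->.
case/mapP => z /allpairsP[[s y] /= [sa yu ->]] -> /=.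
by rewrite count_cat big_cons (letter_countE _ sa) IH //; apply: map_f.
Qed.

Lemma count_reach k u w b : w \in reach k u ->
  count_mem b w = (\sum_(a <- u) iter_count k a b)%N.
Proof.
elim: k w b => [|k IH] w b.
  move/reach0 => ->; elim: u => [|a u IH]; rewrite ?big_nil ?big_cons //=.
  by rewrite IH.
case/mapP => z /allpairsPdep[y [y1 [yu zy ->]]] -> /=.
rewrite (@count_reach1 y.1); last exact: map_f.
rewrite sum_count_mem_nat exchange_big; apply: eq_bigr => d _ /=.
by rewrite (IH y.1) ?big_distrl //; apply: map_f.
Qed.

Lemma size_sum_count w : size w = (\sum_(b : A) count_mem b w)%N.
Proof.
rewrite -sum1_size (sum_count_mem_nat (fun=> 1%N)).
by apply: eq_bigr => b _; rewrite muln1.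
Qed.

Lemma size_reach k u w : w \in reach k u -> size w = word_len k u.
Proof.
move=> wu; rewrite size_sum_count /word_len exchange_big /=.
by apply: eq_bigr => b _; rewrite (count_reach b wu).
Qed.

Lemma iter_lenE k a : iter_len k a = (\sum_b iter_count k a b)%N.
Proof. by []. Qed.

Lemma word_len_cons k a u : word_len k (a :: u) = (iter_len k a + word_len k u)%N.
Proof. exact: big_cons. Qed.

Lemma word_len1 k a : word_len k [:: a] = iter_len k a.
Proof. exact: big_seq1. Qed.

Lemma iter_len_add j k a :
  iter_len (j + k) a = (\sum_d iter_count j a d * iter_len k d)%N.
Proof.
rewrite /iter_len; under eq_bigr do rewrite iter_count_add.
by rewrite exchange_big /=; apply: eq_bigr => d _; rewrite big_distrr.
Qed.

Lemma iter_len1_gt0 a : (0 < iter_len 1 a)%N.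
Proof.
have [s sa] := realisation_ex a.
have : s \in reach 1 [:: a] by rewrite reach1_seq1.
move=> /size_reach; rewrite word_len1 => <-.
by case: s sa => //; rewrite (negPf (nil_notin_realisations th a)).
Qed.

Lemma iter_len_leS k a : (iter_len k a <= iter_len k.+1 a)%N.
Proof.
rewrite -addn1 iter_len_add; apply: leq_sum => d _.
by rewrite leq_pmulr // iter_len1_gt0.
Qed.

Lemma iter_len_le j k a : (j <= k)%N -> (iter_len j a <= iter_len k a)%N.
Proof.
move=> /subnKC <-; elim: (k - j)%N => [|n IH]; first by rewrite addn0.
by rewrite addnS (leq_trans IH) // iter_len_leS.
Qed.

Lemma iter_len_gt0 k a : (0 < iter_len k a)%N.
Proof.
apply: leq_trans (iter_len_le a (leq0n k)).
by rewrite /iter_len (bigD1 a) //= eqxx.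
Qed.

Definition max_len k : nat := \max_a iter_len k a.

Lemma iter_len_max k a : (iter_len k a <= max_len k)%N.
Proof. exact: (@leq_bigmax _ (iter_len k)). Qed.

Lemma word_len_max k u : (word_len k u <= size u * max_len k)%N.
Proof.
elim: u => [|a u IH]; first by rewrite /word_len big_nil.
by rewrite word_len_cons /= mulSn leq_add // iter_len_max.
Qed.

Lemma Ex_size k u : Ex (law th k u) (fun w => (size w)%:R) = (word_len k u)%:R.
Proof.
rewrite (eq_Ex (g := fun=> (word_len k u)%:R)) ?Ex_law_cst //.
by move=> w /size_reach ->.
Qed.

Lemma subst_mxE i j :
  subst_mx th i j = (letter_count (enum_val j) (enum_val i))%:R.
Proof.
rewrite mxE Ex_law1_seq1 big_seq.
rewrite (eq_bigr (fun s => prob th (enum_val j) s *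
  (letter_count (enum_val j) (enum_val i))%:R)).
  by rewrite -big_seq -mulr_suml prob_sum1 mul1r.
by move=> s sj; rewrite occ_seq1 (letter_countE _ sj).
Qed.

Lemma sum_enum_val (F : A -> R) : \sum_(i < #|A|) F (enum_val i) = \sum_a F a.
Proof.
rewrite [RHS](reindex (@enum_val A A)) /=; first exact: eq_bigl.
by apply: onW_bij; apply: enum_val_bij.
Qed.

Lemma subst_mxXE k i j :
  (subst_mx th ^+ k) i j = (iter_count k (enum_val j) (enum_val i))%:R.
Proof.
elim: k i j => [|k IH] i j.
  by rewrite expr0 mxE /= (inj_eq enum_val_inj) eq_sym.
rewrite exprS mxE iter_countS natr_sum -sum_enum_val.
by apply: eq_bigr => d _; rewrite IH subst_mxE -natrM mulnC.
Qed.

Lemma iter_count_primitive : primitive_subst th ->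
  exists2 k, (0 < k)%N & forall a b, (0 < iter_count k a b)%N.
Proof.
case=> -[k k0 k_gt0] _; exists k => // a b.
have := k_gt0 (enum_rank b) (enum_rank a).
by rewrite subst_mxXE !enum_rankK ltr0n.
Qed.

Lemma perron_vector_iter lambda (r : 'cV[R]_#|A|) k b :
  perron_vector (subst_mx th) lambda r ->
  \sum_a (iter_count k a b)%:R * r (enum_rank a) 0 =
    lambda ^+ k * r (enum_rank b) 0.
Proof.
case=> Mr _ _; elim: k b => [|k IH] b.
  rewrite (bigD1 b) //= eqxx !mul1r big1 ?addr0 // => a /negPf ->.
  by rewrite mul0r.
have {}Mr : \sum_d (letter_count d b)%:R * r (enum_rank d) 0 =
    lambda * r (enum_rank b) 0.
  move/matrixP: Mr => /(_ (enum_rank b) 0); rewrite !mxE => <-.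
  rewrite -sum_enum_val; apply: eq_bigr => d _.
  by rewrite subst_mxE enum_valK enum_rankK.
rewrite exprSr -mulrA -Mr mulr_sumr.
under [RHS]eq_bigr => d _ do rewrite mulrCA -IH mulr_sumr.
rewrite exchange_big /=; apply: eq_bigr => a _.
rewrite natr_sum mulr_suml; apply: eq_bigr => d _.
by rewrite natrM mulrCA mulrA.
Qed.

End Compatible.

(** * Power sums of non-negative numbers *)

Section PowerSums.
Variables (R : realType) (q : R).
Hypothesis q_ge0 : 0 <= q.

(* [0 `^ 0 = 1], whereas at q = 0 the power sums below must only count words of
   positive probability. *)
Definition ppow (x : R) : R := if 0 < x then x `^ q else 0.

Lemma ppow_ge0 x : 0 <= ppow x.
Proof. by rewrite /ppow; case: ifP => // _; apply: powR_ge0. Qed.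

Lemma ppow_gt0 x : 0 < x -> 0 < ppow x.
Proof. by move=> x0; rewrite /ppow x0 powR_gt0. Qed.

Lemma ppow0 : ppow 0 = 0.
Proof. by rewrite /ppow ltxx. Qed.

Lemma ppowM x y : 0 <= x -> 0 <= y -> ppow (x * y) = ppow x * ppow y.
Proof.
rewrite !le_eqVlt => /orP[/eqP <-|x0]; first by rewrite mul0r ppow0 mul0r.
case/orP => [/eqP <-|y0]; first by rewrite mulr0 ppow0 mulr0.
by rewrite /ppow mulr_gt0 // x0 y0 powRM // ltW.
Qed.

Lemma le_ppow x y : 0 <= x -> x <= y -> ppow x <= ppow y.
Proof.
move=> x0 xy; rewrite {1}/ppow; case: ifP => [x1|_]; last exact: ppow_ge0.
by rewrite /ppow (lt_le_trans x1 xy) ge0_ler_powR ?nnegrE // (le_trans x0).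
Qed.

(** Some term reaches the average, so the sum is at most [size s] times that term. The argument
    covers all [q >= 0] without separating the concave from the convex case. *)
Lemma ppow_sum_le (I : eqType) (s : seq I) (F : I -> R) :
  {in s, forall i, 0 <= F i} ->
  ppow (\sum_(i <- s) F i) <= (size s)%:R `^ q * \sum_(i <- s) ppow (F i).
Proof.
move=> F0; have S0 : 0 <= \sum_(i <- s) F i by rewrite big_seq sumr_ge0.
have rhs0 : 0 <= (size s)%:R `^ q * \sum_(i <- s) ppow (F i).
  by rewrite mulr_ge0 ?powR_ge0 // sumr_ge0 // => i _; apply: ppow_ge0.
move: S0; rewrite le_eqVlt => /orP[/eqP <-|S0]; first by rewrite ppow0.
have s0 : (0 < size s)%N by case: s S0 {F0 rhs0} => //; rewrite big_nil ltxx.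
have sR : 0 < (size s)%:R :> R by rewrite ltr0n.
have [/hasP[i si hi]|h] := boolP (has (fun i => \sum_(i <- s) F i <= (size s)%:R * F i) s).
  apply: le_trans (le_ppow (ltW S0) hi) _; rewrite ppowM ?F0 //.
  rewrite {1}/ppow sR ler_wpM2l ?powR_ge0 //.
  rewrite (big_rem i) //= lerDl sumr_ge0 // => j _; exact: ppow_ge0.
(* If every term were below the average, summing over [s] would make the total smaller than
   itself. *)
have hlt i : i \in s -> (size s)%:R * F i < \sum_(i <- s) F i.
  by move=> si; rewrite ltNge; apply: contra h => hi; apply/hasP; exists i.
have : \sum_(i <- s) (size s)%:R * F i < \sum_(j <- s) \sum_(i <- s) F i.
  rewrite [ltLHS]big_seq [ltRHS]big_seq; apply: ltr_sum => //.
  by case: s s0 {F0 rhs0 S0 sR h hlt} => // i s _; rewrite /= inE eqxx.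
by rewrite -mulr_sumr big_const_seq count_predT iter_addr addr0 mulr_natl ltxx.
Qed.

Lemma ppow_sum_ge (I : eqType) (s : seq I) (F : I -> R) :
  {in s, forall i, 0 <= F i} ->
  \sum_(i <- s) ppow (F i) <= (size s)%:R * ppow (\sum_(i <- s) F i).
Proof.
move=> F0; rewrite mulr_natl -[leRHS]addr0 -iter_addr -[in leRHS]count_predT.
rewrite -big_const_seq big_seq [leRHS]big_seq; apply: ler_sum => i si.
apply: le_ppow; first exact: F0.
rewrite (big_rem i) //= lerDl big_seq sumr_ge0 // => j /mem_rem; exact: F0.
Qed.

(** At most one term is non-zero, so both sides reduce to its power. *)
Lemma ppow_sum_disjoint (I : eqType) (s : seq I) (F : I -> R) : uniq s ->
  {in s, forall i, 0 <= F i} ->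
  {in s &, forall i j, 0 < F i -> 0 < F j -> i = j} ->
  ppow (\sum_(i <- s) F i) = \sum_(i <- s) ppow (F i).
Proof.
move=> us F0 Fd; have [/hasP[i si Fi]|h] := boolP (has (fun i => 0 < F i) s).
  have z j : j \in s -> j != i -> F j = 0.
    move=> sj ji; apply/eqP; rewrite eq_le F0 // andbT leNgt.
    by apply: contra ji => Fj; rewrite (Fd _ _ sj si).
  rewrite !(bigD1_seq i) //= !big1_seq ?addr0 // => j /andP[ji sj];
    by rewrite z ?ppow0.
have z j : j \in s -> F j = 0.
  move=> sj; apply/eqP; rewrite eq_le F0 // andbT leNgt.
  by apply: contra h => Fj; apply/hasP; exists j.
by rewrite !big1_seq ?ppow0 // => j /andP[_ sj]; rewrite z ?ppow0.
Qed.

End PowerSums.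

Lemma sum_fibers (R : realType) (I J : eqType) (s : seq I) (t : seq J)
    (g : I -> J) (F : I -> R) :
  uniq t -> {in s, forall i, g i \in t} ->
  \sum_(j <- t) \sum_(i <- s | g i == j) F i = \sum_(i <- s) F i.
Proof.
move=> ut gt; under eq_bigr do rewrite big_mkcond.
rewrite exchange_big /= big_seq [RHS]big_seq; apply: eq_bigr => i si.
rewrite (bigD1_seq (g i)) ?gt //= eqxx big1 ?addr0 // => j.
by rewrite eq_sym => /negPf ->.
Qed.

Lemma size_uniq_words (A : finType) (l : nat) (s : seq (seq A)) :
  uniq s -> {in s, forall w, size w = l} -> (size s <= #|A| ^ l)%N.
Proof.
move=> us sl; rewrite -card_tuple cardE -(size_map val).
apply: uniq_leq_size => // w ws.
have szw : size w == l by rewrite sl.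
by apply/mapP; exists (Tuple szw); rewrite ?mem_enum.
Qed.

(** A word of length [L] whose letters in the window are prescribed is determined by its remaining
    [L - n] letters; the map [h] deletes the window. *)
Lemma count_window (A : finType) (L n j : nat) (s : seq (seq A)) (u : seq A) :
  uniq s -> {in s, forall w, size w = L} -> (n + j <= L)%N ->
  (count (fun w => take n (drop j w) == u) s <= #|A| ^ (L - n))%N.
Proof.
move=> us sL njL; rewrite -size_filter.
pose h w : seq A := take j w ++ drop (n + j) w.
rewrite -(size_map h); apply: size_uniq_words.
  rewrite map_inj_in_uniq ?filter_uniq // => x y.
  rewrite !mem_filter => /andP[/eqP xu xs] /andP[/eqP yu ys] /eqP.
  rewrite /h eqseq_cat ?size_takel ?sL //; try lia.
  case/andP => /eqP e1 /eqP e2.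
  rewrite -(cat_take_drop j x) -(cat_take_drop j y) e1; congr (_ ++ _).
  rewrite -(cat_take_drop n (drop j x)) -(cat_take_drop n (drop j y)).
  by rewrite xu yu !drop_drop e2.
move=> z /mapP[w]; rewrite mem_filter => /andP[_ ws] ->.
by rewrite size_cat size_drop size_takel sL //; lia.
Qed.

(** * Partition functions *)

Section PartitionFunction.
Variables (R : realType) (A : alphabetType) (q : R).
Hypothesis q_ge0 : 0 <= q.
Implicit Types (d : word_law R A) (u v w : seq A) (g : seq A -> seq A).

Definition outcomes d : seq (seq A) := undup (unzip1 d).

(** The sum runs over distinct words: a law may list a word repeatedly, and its weights must be
    added before taking powers. *)
Definition partition_fun d : R := \sum_(w <- outcomes d) ppow q (Pr d w).

Lemma outcomes_uniq d : uniq (outcomes d). Proof. exact: undup_uniq. Qed.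

(** Words of probability zero contribute nothing, even at [q = 0], because [ppow q 0 = 0]. Any
    duplicate-free list containing the support may thus serve as index set. *)
Lemma partition_funE d (s : seq (seq A)) : pos_law d -> uniq s ->
  {subset outcomes d <= s} ->
  partition_fun d = \sum_(w <- s) ppow q (Pr d w).
Proof.
move=> d0 us ds; rewrite [RHS](bigID (mem (outcomes d))) /=.
rewrite [X in _ + X]big1 ?addr0 => [|w].
  rewrite -big_filter; apply: perm_big; apply: uniq_perm.
  - exact: outcomes_uniq.
  - exact: filter_uniq.
  move=> w; rewrite mem_filter; apply/idP/andP => [wd|[]//].
  by split=> //; apply: ds.
rewrite mem_undup -Pr_gt0 // -leNgt => h.
by rewrite (_ : Pr d w = 0) ?ppow0 //; apply/eqP; rewrite eq_le h Pr_ge0.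
Qed.

Lemma eq_partition_fun d1 d2 : pos_law d1 -> pos_law d2 -> Pr d1 =1 Pr d2 ->
  partition_fun d1 = partition_fun d2.
Proof.
move=> d10 d20 e; rewrite (@partition_funE d2 (outcomes d1)) ?outcomes_uniq //.
  by apply: eq_bigr => w _; rewrite e.
by move=> w; rewrite !mem_undup -!Pr_gt0 // e.
Qed.

Lemma partition_fun_gt0 d : pos_law d -> d != [::] -> 0 < partition_fun d.
Proof.
move=> d0; case: d d0 => // x d d0 _.
have xd : x.1 \in outcomes (x :: d) by rewrite mem_undup /= inE eqxx.
rewrite /partition_fun (bigD1_seq x.1) ?outcomes_uniq //=.
rewrite ltr_pwDl ?ppow_gt0 //; first by rewrite Pr_gt0 // -mem_undup.
by rewrite sumr_ge0 // => w _; apply: ppow_ge0.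
Qed.

Lemma Ex_outcomes d (f : seq A -> R) :
  Ex d f = \sum_(w <- outcomes d) Pr d w * f w.
Proof.
rewrite /Ex -(@sum_fibers _ _ _ d (outcomes d) fst) ?outcomes_uniq //; last first.
  by move=> x xd; rewrite mem_undup; apply: map_f.
apply: eq_bigr => w _; rewrite /Pr mulr_suml.
by apply: eq_bigr => x /eqP ->.
Qed.

Definition law_map g d : word_law R A := [seq (g x.1, x.2) | x <- d].

Lemma law_map_pos g d : pos_law d -> pos_law (law_map g d).
Proof. by move=> d0 _ /mapP[x xd ->]; exact: (d0 x xd). Qed.

Lemma Pr_law_map g d u :
  Pr (law_map g d) u = Ex d (fun w => (g w == u)%:R).
Proof. by rewrite PrE /Ex big_map. Qed.

Section Fibers.
Variables (g : seq A -> seq A) (d : word_law R A) (F : nat).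
Hypothesis d0 : pos_law d.
Hypothesis fiber : forall u, (count (fun w => g w == u) (outcomes d) <= F)%N.

Let t := undup (map g (outcomes d)).

Let Pr_law_map_sum u : Pr (law_map g d) u =
  \sum_(w <- [seq w <- outcomes d | g w == u]) Pr d w.
Proof.
rewrite Pr_law_map Ex_outcomes big_filter [RHS]big_mkcond.
by apply: eq_bigr => w _; case: eqP; rewrite ?mulr1 ?mulr0.
Qed.

Let partition_fun_law_map :
  partition_fun (law_map g d) = \sum_(u <- t) ppow q (Pr (law_map g d) u).
Proof.
apply: partition_funE; [exact: law_map_pos|exact: undup_uniq|].
move=> u; rewrite !mem_undup => /mapP[_ /mapP[x xd ->] ->] /=.
by apply: map_f; rewrite mem_undup; apply: map_f.
Qed.

Let partition_fun_fibers : partition_fun d =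
  \sum_(u <- t) \sum_(w <- [seq w <- outcomes d | g w == u]) ppow q (Pr d w).
Proof.
under eq_bigr do rewrite big_filter.
rewrite sum_fibers ?undup_uniq // => w wd.
by rewrite mem_undup map_f.
Qed.

(** On each fiber of [g] this is [ppow_sum_le] with at most [F] terms; the reverse estimate below
    uses [ppow_sum_ge]. *)
Lemma partition_fun_law_map_le :
  partition_fun (law_map g d) <= F%:R `^ q * partition_fun d.
Proof.
rewrite partition_fun_law_map partition_fun_fibers mulr_sumr.
apply: ler_sum => u _; rewrite Pr_law_map_sum.
apply: le_trans (ppow_sum_le q_ge0 _) _; first by move=> w _; apply: Pr_ge0.
rewrite ler_wpM2r ?sumr_ge0 // => [w _|]; first exact: ppow_ge0.
by rewrite ge0_ler_powR ?nnegrE // ler_nat size_filter.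
Qed.

Lemma partition_fun_law_map_ge :
  partition_fun d <= F%:R * partition_fun (law_map g d).
Proof.
rewrite partition_fun_law_map partition_fun_fibers mulr_sumr.
apply: ler_sum => u _; rewrite Pr_law_map_sum.
apply: le_trans (ppow_sum_ge q_ge0 _) _; first by move=> w _; apply: Pr_ge0.
by rewrite ler_wpM2r ?ppow_ge0 // ler_nat size_filter.
Qed.

End Fibers.
End PartitionFunction.

(** * Multiplicativity of Z and its recursions *)

Section SubstitutionPartition.
Variables (R : realType) (A : alphabetType) (th : random_substitution R A).
Variable q : R.
Hypothesis compat : compatible_subst th.
Hypothesis q_ge0 : 0 <= q.
Implicit Types (u v w x y : seq A) (a b : A) (k : nat).
Local Notation law := (law th).
Local Notation Z k v := (partition_fun q (law k v)).

Lemma mem_outcomes_law k u w : (w \in outcomes (law k u)) = (w \in reach th k u).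
Proof. exact: mem_undup. Qed.

(** All images of [u] have the same length, so [x ++ y] can be cut in only one way and independence
    gives a product. *)
Lemma Pr_law_cat k u v x y : size x = word_len th k u ->
  Pr (law k (u ++ v)) (x ++ y) = Pr (law k u) x * Pr (law k v) y.
Proof.
move=> sx; rewrite !PrE Ex_law_cat -ExZr; apply: eq_Ex => x' /(size_reach compat) sx'.
rewrite -ExZ; apply: eq_bigr => y' _; congr (_ * _).
by rewrite eqseq_cat ?sx // -mulnb natrM.
Qed.

Lemma partition_fun_law_cat k u v : Z k (u ++ v) = Z k u * Z k v.
Proof.
rewrite (@partition_funE _ _ _ _ [seq x ++ y | x <- outcomes (law k u), y <- outcomes (law k v)]).
- rewrite big_allpairs_dep /= /partition_fun mulr_suml [LHS]big_seq [RHS]big_seq.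
  apply: eq_bigr => x; rewrite mem_outcomes_law => xu.
  rewrite mulr_sumr; apply: eq_bigr => y _.
  by rewrite Pr_law_cat ?ppowM ?(size_reach compat xu) // Pr_ge0 //; apply: law_pos.
- exact: law_pos.
- apply: allpairs_uniq; rewrite ?outcomes_uniq // => -[x y] [x' y'].
  move=> /allpairsP[[x1 y1] /= [xu _ [-> ->]]] /allpairsP[[x2 y2] /= [xu' _ [-> ->]]].
  move: xu xu'; rewrite !mem_outcomes_law => /(size_reach compat) s1 /(size_reach compat) s2.
  by move=> /eqP; rewrite eqseq_cat ?s1 // => /andP[/eqP -> /eqP ->].
move=> w; rewrite mem_outcomes_law => /reach_catP[x [y [xu yv ->]]].
by apply: allpairs_f; rewrite mem_outcomes_law.
Qed.

Lemma partition_fun_law_gt0 k u : 0 < Z k u.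
Proof.
apply: partition_fun_gt0; first exact: law_pos.
by have [w] := reach_ex th k u; rewrite /reach; case: (law k u).
Qed.

Lemma ln_partition_fun_law k u : ln (Z k u) = \sum_(a <- u) ln (Z k [:: a]).
Proof.
have cat1 a v : ln (Z k (a :: v)) = ln (Z k [:: a]) + ln (Z k v).
  by rewrite -cat1s partition_fun_law_cat lnM ?posrE ?partition_fun_law_gt0.
elim: u => [|a u IH]; last by rewrite cat1 IH big_cons.
(* Multiplicativity at the empty word forces [Z k [::]] to be 1, since it is positive. *)
have h : Z k [::] * Z k [::] = Z k [::] * 1 by rewrite mulr1 -partition_fun_law_cat.
by rewrite (mulfI _ h) ?ln1 ?big_nil // gt_eqF // partition_fun_law_gt0.
Qed.

Lemma partition_fun_law1 a :
  Z 1 [:: a] = \sum_(s <- realisations th a) prob th a s `^ q.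
Proof.
rewrite (@partition_funE _ _ _ _ (realisations th a)).
- rewrite big_seq [RHS]big_seq; apply: eq_bigr => s sa.
  by rewrite Pr_law1 /ppow prob_gt0.
- exact: law_pos.
- exact: fset_uniq.
by move=> s; rewrite mem_outcomes_law reach1_seq1.
Qed.

(** Conditioning on the first step, whereas [law] is defined by its last step. *)
Lemma Pr_law_addS k a w : Pr (law k.+1 [:: a]) w =
  \sum_(s <- realisations th a) prob th a s * Pr (law k s) w.
Proof.
rewrite PrE -add1n Ex_law_add Ex_lawS Ex_law0 Ex_law1_seq1.
by apply: eq_bigr => s _; rewrite PrE.
Qed.

(** The right-hand side depends on [a] alone: by compatibility all realisations of [a] share the
    same letter counts, hence the same Z_k. *)
Lemma ln_partition_fun_realisation k a s : s \in realisations th a ->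
  ln (Z k s) = \sum_b (iter_count th 1 a b)%:R * ln (Z k [:: b]).
Proof.
move=> sa; rewrite ln_partition_fun_law sum_count_mem; apply: eq_bigr => b _.
by rewrite (letter_countE compat b sa) iter_count1.
Qed.

Lemma reach_realisation k a s w : s \in realisations th a ->
  w \in reach th k s -> w \in reach th k.+1 [:: a].
Proof.
move=> sa ws; rewrite -add1n; apply/reach_addP.
by exists s; rewrite // reach1_seq1.
Qed.

(** Each word of theta^(k+1)(a) comes from a single realisation of [a], so the power of the sum over
    realisations splits into a sum of powers. *)
Lemma ln_partition_fun_disjoint k a : disjoint_set_condition th -> (0 < k)%N ->
  ln (Z k.+1 [:: a]) = ln (Z 1 [:: a]) +
    \sum_b (iter_count th 1 a b)%:R * ln (Z k [:: b]).
Proof.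
move=> disj k0; have [s0 s0a] := realisation_ex th a.
have -> : Z k.+1 [:: a] = Z 1 [:: a] * Z k s0.
  rewrite partition_fun_law1 mulr_suml [LHS]/partition_fun.
  have Pr_ge s w : 0 <= prob th a s * Pr (law k s) w.
    have [sa|sa] := boolP (s \in realisations th a); last by rewrite prob_eq0 ?mul0r.
    by rewrite mulr_ge0 ?(ltW (prob_gt0 sa)) //; apply: Pr_ge0; apply: law_pos.
  have single w : ppow q (Pr (law k.+1 [:: a]) w) =
      \sum_(s <- realisations th a) ppow q (prob th a s * Pr (law k s) w).
    rewrite Pr_law_addS ppow_sum_disjoint ?fset_uniq // => s t sa ta.
    rewrite !pmulr_rgt0 ?prob_gt0 // => sw tw; apply/eqP/negP => /negP st.
    by have : theta_iter th k s `&` theta_iter th k t = set0 by [exact: disj a _ _ _ k0 sa ta st];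
      move=> /seteqP[/(_ w) + _]; apply.
  under eq_bigr do rewrite single.
  rewrite exchange_big /= big_seq [RHS]big_seq; apply: eq_bigr => s sa.
  have -> : Z k s0 = Z k s.
    apply: ln_inj; rewrite ?posrE ?partition_fun_law_gt0 //.
    by rewrite !(ln_partition_fun_realisation _ sa, ln_partition_fun_realisation _ s0a).
  rewrite (@partition_funE _ _ _ _ (outcomes (law k.+1 [:: a]))) ?outcomes_uniq //.
  - rewrite mulr_sumr; apply: eq_bigr => w _.
    rewrite ppowM ?(ltW (prob_gt0 sa)) //; last by apply: Pr_ge0; apply: law_pos.
    by rewrite /ppow prob_gt0.
  - exact: law_pos.
  by move=> w; rewrite !mem_outcomes_law; apply: reach_realisation.
rewrite lnM ?posrE ?partition_fun_law_gt0 //.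
by rewrite (ln_partition_fun_realisation _ s0a).
Qed.

(** Averaging over the first step changes nothing when all realisations produce a word with equal
    probability, so theta^(k+1)(a) has the law of theta^k(s0). *)
Lemma ln_partition_fun_identical k a : identical_production_probabilities th ->
  (0 < k)%N ->
  ln (Z k.+1 [:: a]) = \sum_b (iter_count th 1 a b)%:R * ln (Z k [:: b]).
Proof.
move=> ident k0; have [s0 s0a] := realisation_ex th a.
rewrite -(ln_partition_fun_realisation _ s0a); congr ln.
apply: eq_partition_fun; [exact: law_pos|exact: law_pos|move=> w].
have [wa|wa] := boolP (w \in reach th k.+1 [:: a]).
  rewrite Pr_law_addS big_seq.
  rewrite (eq_bigr (fun s => prob th a s * Pr (law k s0) w)).
    by rewrite -big_seq -mulr_suml prob_sum1 mul1r.
  move=> s sa; congr (_ * _).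
  by apply: (ident a k.+1) => //; apply/reachP.
(* Outside the support of theta^(k+1)(a) both probabilities vanish. *)
have ws0 : w \notin reach th k s0 by apply: contra wa; apply: reach_realisation.
have z v j : w \notin reach th j v -> Pr (law j v) w = 0.
  move=> wv; apply/eqP; rewrite eq_le Pr_ge0 ?andbT; last exact: law_pos.
  by rewrite leNgt; apply: contra wv => /reachP.
by rewrite !z.
Qed.

End SubstitutionPartition.

(** * Letter frequencies of legal words *)

Section Frequencies.
Variables (R : realType) (A : alphabetType) (th : random_substitution R A).
Hypothesis compat : compatible_subst th.
Hypothesis prim : primitive_subst th.
Variables (lambda : R) (r : A -> R).
Hypothesis lambda_gt1 : 1 < lambda.
Hypothesis r_gt0 : forall a, 0 < r a.
Hypothesis r_sum1 : \sum_a r a = 1.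
Hypothesis r_eigen : forall k b,
  \sum_a (iter_count th k a b)%:R * r a = lambda ^+ k * r b.
(** Stands for the measure of cylinders, as a function on words characterised by its limits. *)
Variable freq : seq A -> R.
Hypothesis freqP : forall v, legal th v -> forall a : A,
  (fun k => Ex (law th k [:: a]) (fun w => (occ v w)%:R) /
            Ex (law th k [:: a]) (fun w => (size w)%:R)) @ \oo --> freq v.
Implicit Types (u v w x y : seq A) (a b : A) (k : nat).
Local Notation reach := (reach th).
Local Notation law := (law th).
Local Notation iter_count := (iter_count th).
Local Notation iter_len := (iter_len th).
Local Notation word_len := (word_len th).
Local Notation max_len := (max_len th).

Lemma sum_iter_len k : \sum_a (iter_len k a)%:R * r a = lambda ^+ k.
Proof.
transitivity (\sum_b lambda ^+ k * r b).
  2: by rewrite -mulr_sumr r_sum1 mulr1.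
under [RHS]eq_bigr do rewrite -r_eigen.
rewrite [RHS]exchange_big /=; apply: eq_bigr => a _.
by rewrite iter_lenE natr_sum mulr_suml.
Qed.

Lemma legal_reach k a w v : (0 < k)%N -> w \in reach k [:: a] -> infix v w ->
  legal th v.
Proof. by move=> k0 /reachP wa vw; exists k, a, w. Qed.

Lemma legalP v : legal th v <->
  exists k a w, [/\ (0 < k)%N, w \in reach k [:: a] & infix v w].
Proof.
split=> -[k [a [w [k0 wa vw]]]]; exists k, a, w; split=> //; exact/reachP.
Qed.

Lemma legal_infix u v : infix u v -> legal th v -> legal th u.
Proof.
move=> uv /legalP[k [a [w [k0 wa vw]]]].
by apply: (legal_reach k0 wa); apply: infix_trans vw.
Qed.

Lemma legal_image k u w : legal th u -> w \in reach k u -> legal th w.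
Proof.
move=> /legalP[j [a [x [j0 xa /infixP[p [s xE]]]]]] wu.
have [y yp] := reach_ex th k p; have [z zs] := reach_ex th k s.
apply: (@legal_reach (j + k) a (y ++ w ++ z)); first by rewrite addn_gt0 j0.
  by apply/reach_addP; exists x => //; rewrite xE !reach_cat.
by apply/infixP; exists y, z.
Qed.

Lemma letter_legal a : legal th [:: a].
Proof.
have [k k0 pos] := iter_count_primitive compat prim.
have [w wa] := reach_ex th k [:: a].
apply: (legal_reach k0 wa).
have : a \in w by rewrite -has_pred1 has_count (count_reach compat a wa) big_seq1.
by rewrite -infix1s.
Qed.

Lemma Ex_occ_letter k a b :
  Ex (law k [:: a]) (fun w => (occ [:: b] w)%:R) = (iter_count k a b)%:R.
Proof.
rewrite (eq_Ex (g := fun=> (iter_count k a b)%:R)) ?Ex_law_cst // => w wa.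
by rewrite occ_seq1 (count_reach compat b wa) big_seq1.
Qed.

Lemma cvg_letter_freq a b :
  (fun k => (iter_count k a b)%:R / (iter_len k a)%:R : R) @ \oo -->
    freq [:: b].
Proof.
have := @freqP _ (letter_legal b) a.
apply: cvg_trans; apply: near_eq_cvg; near=> k.
by rewrite Ex_occ_letter (Ex_size compat) word_len1.
Unshelve. all: by end_near.
Qed.

Lemma iter_len_gt0r k a : 0 < (iter_len k a)%:R :> R.
Proof. by rewrite ltr0n (iter_len_gt0 compat). Qed.

Lemma lambda_gt0 : 0 < lambda.
Proof. exact: lt_trans lambda_gt1. Qed.

(** Finiteness of the alphabet makes the convergence uniform in [a] and [b]. *)
Lemma letter_freq_near (e : R) : 0 < e -> exists N, forall k, (N <= k)%N ->
  forall a b, `|(iter_count k a b)%:R - freq [:: b] * (iter_len k a)%:R| <=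
    e * (iter_len k a)%:R.
Proof.
move=> e0.
have /filter_forall : forall ab : A * A, \forall k \near \oo,
    `|(iter_count k ab.1 ab.2)%:R - freq [:: ab.2] * (iter_len k ab.1)%:R| <=
    e * (iter_len k ab.1)%:R.
  move=> [a b] /=.
  have /cvgrPdist_le /(_ e e0) := @cvg_letter_freq a b.
  apply: filterS => k; have l0 := iter_len_gt0r k a.
  rewrite distrC -(@ler_pM2r _ (iter_len k a)%:R) //.
  rewrite -{2}[(iter_len k a)%:R]gtr0_norm // -normrM mulrBl divfK //.
  by rewrite gt_eqF.
case=> N _ hN; exists N => k Nk a b.
exact: (hN k Nk (a, b)).
Qed.

(* [r b] is a convex combination, with weights [iter_len k a * r a / lambda ^+ k],
   of the ratios [iter_count k a b / iter_len k a]. *)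
Lemma letter_freqE b : freq [:: b] = r b.
Proof.
suff h e : 0 < e -> `|freq [:: b] - r b| <= e.
  apply/eqP; rewrite -subr_eq0 -normr_le0; apply/ler_addgt0Pr => e e0.
  by rewrite add0r h.
move=> e0; have [N /(_ N (leqnn _)) hN] := letter_freq_near e0.
have lN : 0 < lambda ^+ N by rewrite exprn_gt0 // lambda_gt0.
rewrite -(ler_pM2r lN) -[X in `|_| * X](gtr0_norm lN) -normrM.
rewrite mulrBl [r b * _]mulrC -r_eigen -!sum_iter_len !mulr_sumr -sumrB.
apply: le_trans (ler_norm_sum _ _ _) _; apply: ler_sum => a _.
rewrite !mulrA -mulrBl normrM (gtr0_norm (r_gt0 a)) distrC.
by rewrite ler_wpM2r ?(ltW (r_gt0 _)).
Qed.

(** A form of Bernoulli's inequality. *)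
Lemma lambda_exp_ge n : n%:R * (lambda - 1) <= lambda ^+ n.
Proof.
elim: n => [|n IH]; first by rewrite mul0r expr0.
have h : 1 <= lambda ^+ n by rewrite exprn_ege1 // ltW.
rewrite exprS -natr1.
have : 0 <= (lambda - 1) * (lambda ^+ n - 1).
  by rewrite mulr_ge0 ?subr_ge0 // ltW.
nra.
Qed.

(** By primitivity theta^k0(a) contains every letter. Hence theta^(k0+N)(a) is at least as long as
    the sum of all [iter_len N d], which is at least their [r]-average [lambda ^+ N]. *)
Lemma iter_len_large (C : R) : exists N, forall k, (N <= k)%N -> forall a,
  C <= (iter_len k a)%:R.
Proof.
have [k0 _ pos] := iter_count_primitive compat prim.
have [N hN] : exists N : nat, C <= N%:R * (lambda - 1).
  have [N _ /(_ N (leqnn N)) hN] := nbhs_infty_gtr (C / (lambda - 1)).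
  by exists N; rewrite -ler_pdivrMr ?subr_gt0 // ltW.
exists (k0 + N)%N => k Nk a.
apply: le_trans hN _; apply: le_trans (lambda_exp_ge N) _.
apply: le_trans (_ : (iter_len (k0 + N) a)%:R <= _); last first.
  by rewrite ler_nat (iter_len_le compat).
rewrite -sum_iter_len iter_len_add natr_sum; apply: ler_sum => d _.
rewrite mulrC natrM ler_wpM2r //.
have rd : r d <= 1 by rewrite -r_sum1 (bigD1 d) //= lerDl sumr_ge0 // => b _; apply: ltW.
by apply: le_trans rd _; rewrite ler1n.
Qed.

Definition mean (g : A -> R) : R := \sum_b r b * g b.

Lemma mean_iter_len k : mean (fun a => (iter_len k a)%:R) = lambda ^+ k.
Proof. by rewrite -sum_iter_len; apply: eq_bigr => a _; rewrite mulrC. Qed.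

(* Legal words are, up to boundary pieces of bounded length, concatenations of
   realisations of theta^N on letters, in which the letters are almost
   distributed as r. *)
Lemma legal_mean (g : A -> R) (e : R) : 0 < e -> exists2 C : R, 0 <= C &
  forall v, legal th v ->
    `|\sum_(a <- v) g a - (size v)%:R * mean g| <= e * (size v)%:R + C.
Proof.
(* Centring [g] turns the claim into a bound on the additive function [D]. *)
move=> e0; pose h a := g a - mean g; pose D v := \sum_(a <- v) h a.
have DE v : \sum_(a <- v) g a - (size v)%:R * mean g = D v.
  by rewrite /D sumrB big_const_seq count_predT iter_addr addr0 mulr_natl.
pose G := \sum_a `|h a|; have G0 : 0 <= G by apply: sumr_ge0.
have hG a : `|h a| <= G by rewrite /G (bigD1 a) //= lerDl sumr_ge0.
have Dcat x y : D (x ++ y) = D x + D y by exact: big_cat.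
have Dsize x : `|D x| <= (size x)%:R * G.
  apply: le_trans (ler_norm_sum _ _ _) _.
  elim: x => [|a x IH]; first by rewrite big_nil mul0r.
  by rewrite big_cons /= -natr1 mulrDl mul1r addrC lerD.
(* The precision is divided by the total size [G] of [h]; adding 1 covers [G = 0]. *)
have e'0 : 0 < e / (G + 1) by rewrite divr_gt0 // ltr_wpDl.
have [N /(_ N (leqnn _)) hN] := letter_freq_near e'0.
have Dblock x a : x \in reach N [:: a] -> `|D x| <= e * (size x)%:R.
  move=> xa; rewrite (size_reach compat xa) word_len1.
  have hmean : \sum_b r b * h b = 0.
    rewrite /h; under eq_bigr do rewrite mulrBr.
    by rewrite sumrB -/(mean g) -mulr_suml r_sum1 mul1r subrr.
  rewrite /D sum_count_mem.
  have -> : \sum_b (count_mem b x)%:R * h b =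
      \sum_b ((iter_count N a b)%:R - freq [:: b] * (iter_len N a)%:R) * h b.
    (* The subtracted terms sum to zero, since [freq [:: b] = r b] and [h] has mean zero. *)
    apply/eqP; rewrite -subr_eq0 -sumrB; apply/eqP.
    transitivity ((iter_len N a)%:R * \sum_b r b * h b); last by rewrite hmean mulr0.
    rewrite mulr_sumr; apply: eq_bigr => b _.
    by rewrite (count_reach compat b xa) big_seq1 letter_freqE; ring.
  apply: le_trans (ler_norm_sum _ _ _) _.
  apply: (@le_trans _ _ (\sum_b (e / (G + 1) * (iter_len N a)%:R) * `|h b|)).
    by apply: ler_sum => b _; rewrite normrM ler_wpM2r.
  rewrite -mulr_sumr -/G mulrAC ler_wpM2r //.
  rewrite -mulrA ler_piMr ?(ltW e0) // mulrC ler_pdivrMr ?ltr_wpDl //.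
  by rewrite mul1r lerDl.
pose L : R := (max_len N)%:R.
have DL x n : (n <= max_len N)%N -> (size x <= n)%N -> `|D x| <= L * G.
  move=> nL xn; apply: le_trans (Dsize x) _.
  by rewrite ler_wpM2r // ler_nat (leq_trans xn).
have Dpiece x s a : s \in reach N [:: a] -> (size x <= size s)%N -> `|D x| <= L * G.
  move=> sa; apply: DL.
  by rewrite (size_reach compat sa) word_len1 iter_len_max.
(* A prefix of theta^N(u) consists of full blocks and at most one cut block, which costs [L * G]. *)
have Dpre u : forall w n, w \in reach N u ->
    `|D (take n w)| <= e * (size (take n w))%:R + L * G.
  have LG0 : 0 <= L * G by rewrite mulr_ge0 ?ler0n.
  elim: u => [|a u IH] w n.
    by move=> /reach_nil ->; rewrite /D big_nil normr0 addr_ge0 // mulr_ge0 // ltW.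
  rewrite -cat1s => /reach_catP[s [y [sa yu ->]]]; rewrite take_cat; case: ifP => _.
    apply: le_trans (Dpiece _ _ _ sa _) _; first by rewrite size_take; case: ltnP => // /ltnW.
    by rewrite lerDr mulr_ge0 // ltW.
  rewrite Dcat size_cat natrD mulrDr -addrA.
  by apply: le_trans (ler_normD _ _) _; rewrite lerD ?IH ?(Dblock _ a).
(* A general subword has a cut block at each end. *)
have Dinf u : forall w i n, w \in reach N u ->
    `|D (take n (drop i w))| <= e * (size (take n (drop i w)))%:R + 2 * L * G.
  have LG0 : 0 <= L * G by rewrite mulr_ge0 ?ler0n.
  have LG20 : 0 <= 2 * L * G by rewrite -mulrA mulr_ge0.
  elim: u => [|a u IH] w i n.
    by move=> /reach_nil ->; rewrite /D big_nil normr0 addr_ge0 // mulr_ge0 // ltW.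
  rewrite -cat1s => /reach_catP[s [y [sa yu ->]]]; rewrite drop_cat; case: ifP => _.
    rewrite take_cat; case: ifP => _.
      apply: le_trans (Dpiece _ _ _ sa _) _.
        rewrite size_take size_drop; case: ltnP => [/ltnW h1|_]; last exact: leq_subr.
        by apply: leq_trans h1 _; exact: leq_subr.
      rewrite -[L * G]add0r lerD ?mulr_ge0 ?(ltW e0) // -mulrA mulr_natl mulr2n.
      by rewrite lerDl.
    rewrite Dcat size_cat natrD mulrDr.
    apply: le_trans (ler_normD _ _) _.
    have h1 : `|D (drop i s)| <= L * G.
      by apply: (Dpiece _ _ _ sa); rewrite size_drop leq_subr.
    have h2 := Dpre _ _ (n - size (drop i s))%N yu.
    have h3 : 0 <= e * (size (drop i s))%:R by rewrite mulr_ge0 // ltW.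
    move: h1 h2 h3; set z := _ * (size (drop i s))%:R; lra.
  exact: IH.
exists (2 * L * G); first by rewrite !mulr_ge0.
move=> v /legalP[K [a [w [K0 wa /infixP[p [s wE]]]]]]; rewrite DE.
(* Either theta^K(a) is itself an N-th image, or [K < N] and [v] is no longer than [max_len N]. *)
have [NK|KN] := leqP N K.
  move: wa; rewrite -(subnK NK) => /reach_addP[x xa wx].
  have -> : v = take (size v) (drop (size p) w).
    by rewrite wE drop_size_cat // take_size_cat.
  exact: Dinf wx.
apply: (@le_trans _ _ (L * G)).
  apply: (DL _ (max_len N)) => //; apply: leq_trans (iter_len_max th N a).
  apply: leq_trans (iter_len_le compat a (ltnW KN)).
  rewrite -word_len1 -(size_reach compat wa) wE !size_cat.
  by rewrite addnCA leq_addr.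
have LG0 : 0 <= L * G by rewrite mulr_ge0 ?ler0n.
have h3 : 0 <= e * (size v)%:R by rewrite mulr_ge0 // ltW.
lra.
Qed.

(** * Occurrences in images and bounds on cylinder frequencies *)

Lemma occ_cat u x y : (occ u x + occ u y <= occ u (x ++ y))%N.
Proof.
elim: x => [|a x IH]; first by rewrite occ_nil.
rewrite /= !occ_cons -addnA leq_add //; case: (boolP (prefix u (a :: x))) => //.
by move=> /(prefix_catl y) /= ->.
Qed.

Lemma occ_cat_prefix u x y : x != [::] ->
  (prefix u (x ++ y) + occ u y <= occ u (x ++ y))%N.
Proof.
case: x => // a x _; rewrite /= occ_cons leq_add2l.
by apply: leq_trans (occ_cat _ _ _); rewrite leq_addl.
Qed.

Lemma occ_catE u x y : occ u (x ++ y) =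
  (\sum_(0 <= p < size x) prefix u (drop p (x ++ y)) + occ u y)%N.
Proof.
elim: x => [|a x IH]; first by rewrite big_geq.
by rewrite /= occ_cons IH big_nat_recl //= addnA.
Qed.

Lemma occ_infix u w : u != [::] -> infix u w -> (0 < occ u w)%N.
Proof.
move=> u0 /infixP[p [s ->]]; apply: leq_trans (occ_cat _ _ _).
rewrite ltn_addl //; apply: leq_trans (occ_cat _ _ _); rewrite ltn_addr //.
by case: u u0 => // a u _; rewrite occ_cons prefix_refl.
Qed.

Lemma reach_neq0 k a w : w \in reach k [:: a] -> w != [::].
Proof.
move=> wa; rewrite -size_eq0 (size_reach compat wa) word_len1.
by rewrite -lt0n (iter_len_gt0 compat).
Qed.

Lemma Ex_prefix_cat k u v s :
  Ex (law k v) (fun x => (prefix u x)%:R) <=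
  Ex (law k (v ++ s)) (fun x => (prefix u x)%:R).
Proof.
rewrite Ex_law_cat; apply: le_Ex => [|x _]; first exact: law_pos.
rewrite -{1}(Ex_law_cst th k s (prefix u x)%:R).
apply: le_Ex => [|y _]; first exact: law_pos.
by rewrite ler_nat; case: (boolP (prefix u x)) => // /(prefix_catl y) ->.
Qed.

Lemma Ex_occ_cons k u a w :
  Ex (law k (a :: w)) (fun x => (prefix u x)%:R) +
  Ex (law k w) (fun x => (occ u x)%:R) <=
  Ex (law k (a :: w)) (fun x => (occ u x)%:R).
Proof.
rewrite -cat1s !Ex_law_cat.
rewrite -[X in _ + X](Ex_law_cst th k [:: a]) -ExD.
apply: le_Ex => [|x xa]; first exact: law_pos.
rewrite -ExD; apply: le_Ex => [|y _]; first exact: law_pos.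
by rewrite -natrD ler_nat occ_cat_prefix // (reach_neq0 xa).
Qed.

(** Each occurrence of [v] in [w] gives [u] a chance to begin the image of that occurrence.
    Different occurrences yield different positions, as images of letters are non-empty. *)
Lemma Ex_occ_ge k u v w :
  (occ v w)%:R * Ex (law k v) (fun x => (prefix u x)%:R) <=
  Ex (law k w) (fun x => (occ u x)%:R).
Proof.
elim: w => [|a w IH]; first by rewrite mul0r Ex_law_nil.
apply: le_trans (Ex_occ_cons _ _ _ _); rewrite occ_cons natrD mulrDl lerD //.
have [/prefixP[s ->]|_] := boolP (prefix v (a :: w)).
  by rewrite mul1r Ex_prefix_cat.
by rewrite mul0r; apply: Ex_ge0 => //; apply: law_pos.
Qed.

Lemma Ex_occ_letter_ge k u a w :
  (occ [:: a] w)%:R * Ex (law k [:: a]) (fun x => (occ u x)%:R) <=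
  Ex (law k w) (fun x => (occ u x)%:R).
Proof.
elim: w => [|b w IH]; first by rewrite mul0r Ex_law_nil.
rewrite occ_cons natrD mulrDl /= prefix0s andbT.
rewrite -(cat1s b w) (Ex_law_cat th k [:: b] w).
apply: (@le_trans _ _ (Ex (law k [:: b]) (fun x => (occ u x)%:R +
   Ex (law k w) (fun y => (occ u y)%:R)))).
  rewrite ExD Ex_law_cst lerD //.
  have [->|_] := eqVneq a b; first by rewrite mul1r.
  by rewrite mul0r; apply: Ex_ge0 => //; apply: law_pos.
apply: le_Ex => [|x xb]; first exact: law_pos.
rewrite -{1}(Ex_law_cst th k w (occ u x)%:R) -ExD.
apply: le_Ex => [|y _]; first exact: law_pos.
by rewrite -natrD ler_nat occ_cat.
Qed.

Local Notation ratio u k :=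
  (Ex (law k [:: point]) (fun w => (occ u w)%:R) / (iter_len k point)%:R : R).

Lemma cvg_ratio u : legal th u -> (fun k => ratio u k) @ \oo --> freq u.
Proof.
move=> lu; have := @freqP _ lu point.
apply: cvg_trans; apply: near_eq_cvg; near=> k.
by rewrite (Ex_size compat) word_len1.
Unshelve. all: by end_near.
Qed.

Lemma cvg_ratio_add j u : legal th u -> (fun k => ratio u (k + j)%N) @ \oo --> freq u.
Proof. by move=> /cvg_ratio; rewrite -(cvg_shiftn j). Qed.

Lemma freq_ge0 u : legal th u -> 0 <= freq u.
Proof.
move=> lu; apply: (ler_cvg_to (cvg_cst 0) (cvg_ratio lu)).
apply: nearW => k; rewrite divr_ge0 //; apply: Ex_ge0 => //; exact: law_pos.
Qed.

Lemma max_len_gt0 k : 0 < (max_len k)%:R :> R.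
Proof. by rewrite ltr0n (leq_trans (iter_len_gt0 compat k point)) // iter_len_max. Qed.

Lemma iter_len_add_max j k a : (iter_len (j + k) a <= iter_len j a * max_len k)%N.
Proof.
rewrite iter_len_add iter_lenE big_distrl /=.
by apply: leq_sum => d _; rewrite leq_mul // iter_len_max.
Qed.

(** The bound [hp] is averaged over the words of theta^K(point) and divided by the length of
    theta^(K+k)(point), which is at most [max_len k] times that of theta^K(point); then [K] tends to
    infinity. *)
Lemma freq_ge_of_occ k u v (p : R) : legal th u -> legal th v -> 0 <= p ->
  (forall w, (occ v w)%:R * p <= Ex (law k w) (fun x => (occ u x)%:R)) ->
  p / (max_len k)%:R * freq v <= freq u.
Proof.
move=> lu lv p0 hp.
have hc : (fun K => p / (max_len k)%:R * ratio v K) @ \oo -->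
    p / (max_len k)%:R * freq v.
  by apply: cvgM; [exact: cvg_cst|exact: cvg_ratio].
apply: (ler_cvg_to hc (@cvg_ratio_add k u lu)).
apply: nearW => K /=; rewrite Ex_law_add.
rewrite mulrACA -invfM ler_pM //.
- by rewrite mulr_ge0 //; apply: Ex_ge0 => //; apply: law_pos.
- rewrite mulrC -ExZr; apply: le_Ex => [|w _]; [exact: law_pos|exact: hp].
- rewrite lef_pV2 ?posrE ?mulr_gt0 ?max_len_gt0 ?iter_len_gt0r //.
  by rewrite -natrM ler_nat mulnC iter_len_add_max.
Qed.

Lemma freq_gt0 u : legal th u -> u != [::] -> 0 < freq u.
Proof.
move=> lu u0; have /legalP[k [a [w [k0 wa uw]]]] := lu.
have p0 : 0 < Ex (law k [:: a]) (fun x => (occ u x)%:R) :> R.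
  by apply/Ex_gt0P => //; [exact: law_pos|exists w; rewrite ?ltr0n ?occ_infix].
have := freq_ge_of_occ lu (letter_legal a) (ltW p0) (Ex_occ_letter_ge k u a).
apply: lt_le_trans; rewrite letter_freqE mulr_gt0 ?r_gt0 //.
by rewrite divr_gt0 // max_len_gt0.
Qed.

Lemma freq_ge k u v : legal th u -> legal th v ->
  Ex (law k v) (fun x => (prefix u x)%:R) / (max_len k)%:R * freq v <= freq u.
Proof.
move=> lu lv; apply: freq_ge_of_occ => // [|w]; last exact: Ex_occ_ge.
by apply: Ex_ge0 => //; exact: law_pos.
Qed.

(** All but at most [m] positions of [w] start a subword of length [m]. *)
Lemma sum_occ m w : (forall u, infix u w -> legal th u) ->
  (size w <= \sum_(v : m.-tuple A | `[< legal th v >]) occ v w + m)%N.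
Proof.
elim: w => [|a w IH] lw //.
have {}IH : (size w <= \sum_(v : m.-tuple A | `[< legal th v >]) occ v w + m)%N.
  by apply: IH => u uw; apply: lw; apply: (infix_catl [:: a]).
have [wm|mw] := leqP (size (a :: w)) m; first by apply: leq_trans wm (leq_addl _ _).
under eq_bigr do rewrite occ_cons.
rewrite big_split /= -addnA -add1n leq_add //.
have szv : size (take m (a :: w)) == m by rewrite size_take mw.
have lv : legal th (Tuple szv).
  by apply: lw; apply: infix_take.
rewrite (bigD1 (Tuple szv)); last exact/asboolP.
have pv : (0 < prefix (Tuple szv) (a :: w))%N by rewrite prefix_take.
by apply: leq_trans pv _; apply: leq_addr.
Qed.

Lemma sum_freq m : 1 <= \sum_(v : m.-tuple A | `[< legal th v >]) freq v.
Proof.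
have cvS : (fun k => \sum_(v : m.-tuple A | `[< legal th v >]) ratio v k) @ \oo -->
    \sum_(v : m.-tuple A | `[< legal th v >]) freq v.
  apply: cvg_big => [|v /asboolP lv]; last exact: cvg_ratio.
  exact: add_continuous.
apply/ler_addgt0Pr => e e0; rewrite -lerBlDr.
apply: (ler_cvg_to (cvg_cst _) cvS).
have [N hN] := iter_len_large (m%:R / e).
(* The successor keeps [k] positive, as the definition of legality demands. *)
exists N.+1 => // k /= Nk.
have l0 := iter_len_gt0r k point.
rewrite -mulr_suml ler_pdivlMr // mulrBl mul1r lerBlDr.
rewrite -Ex_sum.
apply: (@le_trans _ _ (Ex (law k [:: point]) (fun w =>
   \sum_(v : m.-tuple A | `[< legal th v >]) (occ v w)%:R) + m%:R)); last first.
  by rewrite lerD2l mulrC -ler_pdivrMr // hN // ltnW.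
rewrite -word_len1 -(Ex_size compat).
rewrite -(Ex_law_cst th k [:: point] m%:R) -ExD.
apply: le_Ex => [|w wk]; first exact: law_pos.
rewrite -natr_sum -natrD ler_nat; apply: sum_occ => u uw.
by apply: legal_reach wk uw; apply: leq_trans Nk.
Qed.

(** Pigeonhole: at most [#|A| ^ m] frequencies have total at least 1. *)
Lemma freq_large m : exists v : seq A,
  [/\ legal th v, size v = m & (#|A| ^ m)%:R^-1 <= freq v].
Proof.
have [[v [/asboolP lv hv]]|h] := pselect (exists v : m.-tuple A,
    `[< legal th v >] /\ (#|A| ^ m)%:R^-1 <= freq v).
  by exists v; rewrite size_tuple.
have c0 : 0 < (#|A| ^ m)%:R :> R.
  by rewrite ltr0n expn_gt0; apply/orP; left; apply/card_gt0P; exists point.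
have := sum_freq m; rewrite leNgt => /negP[].
have hlt (v : m.-tuple A) : `[< legal th v >] -> freq v < (#|A| ^ m)%:R^-1.
  by move=> lv; rewrite ltNge; apply/negP => hv; apply: h; exists v.
have [[v lv]|h0] := pselect (exists v : m.-tuple A, `[< legal th v >]); last first.
  by rewrite big1 // => v lv; case: h0; exists v.
rewrite (bigD1 v) //=.
apply: (@lt_le_trans _ _ ((#|A| ^ m)%:R^-1 +
   \sum_(i : m.-tuple A | i != v) (#|A| ^ m)%:R^-1)).
  rewrite ltr_leD ?hlt // big_mkcond [leRHS]big_mkcond /=.
  apply: ler_sum => i _; case: (i != v); rewrite ?andbF // andbT.
  by case: ifP => [li|_]; rewrite ?invr_ge0 // ltW // hlt.
suff : \sum_(i : m.-tuple A) (#|A| ^ m)%:R^-1 = 1 :> R.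
  by rewrite (bigD1 v) //= => ->.
by rewrite sumr_const card_tuple -[LHS]mulr_natl divff // gt_eqF.
Qed.

Lemma Ex_prefix_drop k u v s j : (size u + j <= word_len k v)%N ->
  Ex (law k (v ++ s)) (fun x => (prefix u (drop j x))%:R) =
  Ex (law k v) (fun x => (take (size u) (drop j x) == u)%:R) :> R.
Proof.
move=> hv; rewrite Ex_law_cat; apply: eq_Ex => x /(size_reach compat) xv.
rewrite (eq_Ex (g := fun=> (take (size u) (drop j x) == u)%:R)) ?Ex_law_cst //.
move=> y _; rewrite prefixE; congr (_ == _)%:R.
rewrite drop_cat; case: ltnP => [jx|]; last first.
  (* The window can begin at or beyond the end of the image of [v] only if [u] is empty. *)
  rewrite xv => xj; have u0 : size u = 0%N by lia.
  by rewrite u0 !take0.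
by rewrite takel_cat // size_drop xv leq_subRL // -?xv ?(ltnW jx) // addnC xv.
Qed.

(** An occurrence of [u] in theta^k(w) starts in the image of some letter, at an offset below
    [max_len k]. If at least [m] letters of [w] remain from there, it lies inside the image of the
    next [m] letters and [B] applies; the remaining positions number at most [m * max_len k]. *)
Lemma Ex_occ_le k u m (B : R) w : 0 <= B ->
  (forall v, legal th v -> size v = m ->
    (size u + max_len k <= word_len k v)%N) ->
  (forall v, legal th v -> size v = m -> forall j, (j < max_len k)%N ->
    Ex (law k v) (fun x => (take (size u) (drop j x) == u)%:R) <= B) ->
  (forall v, infix v w -> legal th v) ->
  Ex (law k w) (fun x => (occ u x)%:R) <=
    (word_len k w)%:R * B + (m * max_len k)%:R.
Proof.
move=> B0 hsz hB; elim: w => [|a w IH] lw.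
  by rewrite Ex_law_nil occ_nil addr_ge0 // mulr_ge0.
have {}IH := IH (fun v vw => lw v (infix_catl [:: a] vw)).
have [wm|mw] := ltnP (size (a :: w)) m.
  rewrite -[leLHS]add0r lerD ?mulr_ge0 //.
  rewrite -(Ex_law_cst th k (a :: w) (m * max_len k)%:R).
  apply: le_Ex => [|x xw]; first exact: law_pos.
  rewrite ler_nat; apply: leq_trans (_ : size x <= _)%N.
    by rewrite /occ (leq_trans (count_size _ _)) // size_iota.
  rewrite (size_reach compat xw) (leq_trans (word_len_max _ _ _)) //.
  by rewrite leq_mul2r (ltnW wm) orbT.
have -> : Ex (law k (a :: w)) (fun x => (occ u x)%:R) =
    \sum_(0 <= p < iter_len k a)
      Ex (law k (a :: w)) (fun x => (prefix u (drop p x))%:R) +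
    Ex (law k w) (fun x => (occ u x)%:R) :> R.
  rewrite -(cat1s a w) Ex_law_cat.
  under [X in _ = X + _]eq_bigr do rewrite Ex_law_cat.
  rewrite -Ex_sum -[X in _ + X](Ex_law_cst th k [:: a]) -ExD.
  apply: eq_Ex => x xa; rewrite -Ex_sum -ExD; apply: eq_bigr => y _.
  congr (_ * _); rewrite occ_catE (size_reach compat xa) word_len1.
  by rewrite natrD natr_sum.
rewrite word_len_cons natrD mulrDl -addrA lerD //.
rewrite mulr_natl -[X in B *+ X]subn0 -sumr_const_nat; apply: ler_sum_nat => p /andP[_ pa].
have lv : legal th (take m (a :: w)) by apply: lw; apply: infix_take.
have sv : size (take m (a :: w)) = m by rewrite size_takel.
have pm : (p < max_len k)%N by apply: leq_trans pa (iter_len_max _ _ _).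
rewrite -{1}(cat_take_drop m (a :: w)) Ex_prefix_drop; first exact: hB.
by apply: leq_trans (hsz _ lv sv); rewrite leq_add2l ltnW.
Qed.

Lemma freq_le k u m (B : R) : legal th u -> 0 <= B ->
  (forall v, legal th v -> size v = m ->
    (size u + max_len k <= word_len k v)%N) ->
  (forall v, legal th v -> size v = m -> forall j, (j < max_len k)%N ->
    Ex (law k v) (fun x => (take (size u) (drop j x) == u)%:R) <= B) ->
  freq u <= B.
Proof.
move=> lu B0 hsz hB; apply/ler_addgt0Pr => e e0.
apply: (ler_cvg_to (@cvg_ratio_add k u lu) (cvg_cst _)).
have [N hN] := iter_len_large ((m * max_len k)%:R / e).
exists N.+1 => // K /= NK; have l0 := iter_len_gt0r (K + k) point.
rewrite ler_pdivrMr // mulrDl.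
apply: (@le_trans _ _ (B * (iter_len (K + k) point)%:R + (m * max_len k)%:R)).
  rewrite -word_len1 -(Ex_size compat) !Ex_law_add -ExZ.
  rewrite -(Ex_law_cst th K [:: point] (m * max_len k)%:R) -ExD.
  apply: le_Ex => [|w wK]; first exact: law_pos.
  rewrite (Ex_size compat) mulrC; apply: Ex_occ_le => // v vw.
  by apply: legal_reach wK vw; apply: leq_trans NK.
by rewrite lerD2l mulrC -ler_pdivrMr // hN // (leq_trans (ltnW NK)) // leq_addr.
Qed.

(** * Bounds on the power sums of the frequency measure *)

Variable q : R.
Hypothesis q_ge0 : 0 <= q.
Local Notation Z k v := (partition_fun q (law k v)).

(* The law of the n letters of theta^k(v) that start at position j. *)
Definition window k n j v : word_law R A :=
  law_map (fun x => take n (drop j x)) (law k v).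

Lemma window_pos k n j v : pos_law (window k n j v).
Proof. by apply: law_map_pos; apply: law_pos. Qed.

Lemma size_window k n j v w : (n + j <= word_len k v)%N ->
  w \in outcomes (window k n j v) -> size w = n.
Proof.
move=> nj; rewrite mem_undup => /mapP[_ /mapP[x xd ->] ->] /=.
have /(size_reach compat) sx : x.1 \in reach k v by apply: map_f.
by rewrite size_takel // size_drop sx; lia.
Qed.

Lemma partition_fun_tuple k n j v : (n + j <= word_len k v)%N ->
  partition_fun q (window k n j v) =
    \sum_(u : n.-tuple A) ppow q (Pr (window k n j v) u).
Proof.
move=> nj; rewrite (@partition_funE _ _ _ _ (map val (enum {: n.-tuple A}))).
- by rewrite big_map big_enum.
- exact: window_pos.
- by rewrite map_inj_uniq ?enum_uniq //; apply: val_inj.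
move=> w /(size_window nj) /eqP sw.
by apply/mapP; exists (Tuple sw); rewrite ?mem_enum.
Qed.

Lemma count_outcomes_window k n j v E u :
  (n + j <= word_len k v)%N -> (word_len k v <= n + E)%N ->
  (count (fun x => take n (drop j x) == u) (outcomes (law k v)) <= #|A| ^ E)%N.
Proof.
move=> nj nE; apply: leq_trans (_ : #|A| ^ (word_len k v - n) <= _)%N.
  apply: count_window => //; first exact: outcomes_uniq.
  by move=> w; rewrite mem_outcomes_law => /(size_reach compat).
rewrite leq_pexp2l //; last by lia.
by apply/card_gt0P; exists point.
Qed.

Definition power_sum n : R :=
  \sum_(u : n.-tuple A | `[< legal th u >]) freq u `^ q.

Lemma power_sumE n : (0 < n)%N -> power_sum n =
  \sum_(u : n.-tuple A | `[< legal th u >]) ppow q (freq u).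
Proof.
move=> n0; apply: eq_bigr => u /asboolP lu.
by rewrite /ppow freq_gt0 // -size_eq0 size_tuple -lt0n.
Qed.

(** With [N = #|A| ^ m * max_len k] pairs [(v, j)], bounding [freq u] by the sum of the window
    probabilities costs [N] to the power [q], truncation to the window costs [#|A| ^ E] to the power
    [q], and the sum over the pairs costs another [N]. *)
Lemma power_sum_le k n m E (zmax : R) : (0 < n)%N -> 0 <= zmax ->
  (forall v, legal th v -> size v = m ->
    [/\ (n + max_len k <= word_len k v)%N, (word_len k v <= n + E)%N &
        Z k v <= zmax]) ->
  power_sum n <= (#|A| ^ m * max_len k)%:R `^ q * ((#|A| ^ m * max_len k)%:R *
    ((#|A| ^ E)%:R `^ q * zmax)).
Proof.
move=> n0 zmax0 hv.
pose vs := [seq tval v | v : m.-tuple A <- enum {: m.-tuple A} & `[< legal th v >]].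
pose I := [seq (v, j) | v <- vs, j <- iota 0 (max_len k)].
pose N : nat := (#|A| ^ m * max_len k)%N.
have sI : (size I <= N)%N.
  rewrite size_allpairs size_iota size_map size_filter leq_mul2r.
  by rewrite (leq_trans (count_size _ _)) ?orbT // -cardE card_tuple.
have vI i : i \in I -> [/\ legal th i.1, size i.1 = m & (i.2 < max_len k)%N].
  move=> /allpairsP[[v j] /= [vv jI ->]] /=.
  move: vv => /mapP[t]; rewrite mem_filter => /andP[/asboolP lt _] -> .
  by split; rewrite ?size_tuple //; move: jI; rewrite mem_iota.
have Iv v j : legal th v -> size v = m -> (j < max_len k)%N -> (v, j) \in I.
  move=> lv /eqP sv jk; apply: allpairs_f; last by rewrite mem_iota.
  by apply/mapP; exists (Tuple sv); rewrite // mem_filter mem_enum andbT; apply/asboolP.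
pose P (i : seq A * nat) u := Pr (window k n i.2 i.1) u.
have P0 i u : 0 <= P i u by apply: Pr_ge0; apply: window_pos.
have freqI u : legal th u -> size u = n -> freq u <= \sum_(i <- I) P i u.
  move=> lu su; apply: (@freq_le k u m) => //; first by apply: sumr_ge0.
    by move=> v lv sv; rewrite su; case: (hv v lv sv).
  (* The bound given to [freq_le] is the whole sum over [I], which dominates each of its terms. *)
  move=> v lv sv j jk; rewrite su (big_rem (v, j)) ?Iv //=.
  by rewrite {1}/P /window Pr_law_map lerDl sumr_ge0.
have NR : 0 <= N%:R :> R by [].
rewrite power_sumE // -/N.
apply: (@le_trans _ _ (\sum_(u : n.-tuple A)
   N%:R `^ q * \sum_(i <- I) ppow q (P i u))).
  rewrite big_mkcond; apply: ler_sum => u _.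
  have S0 : 0 <= \sum_(i <- I) ppow q (P i u).
    by apply: sumr_ge0 => i _; apply: ppow_ge0.
  case: ifP => [/asboolP lu|_]; last by rewrite mulr_ge0 ?powR_ge0.
  apply: le_trans (_ : ppow q (\sum_(i <- I) P i u) <= _).
    by apply: le_ppow; rewrite ?freq_ge0 // freqI // size_tuple.
  apply: le_trans (ppow_sum_le q_ge0 _) _ => //.
  by rewrite ler_wpM2r // ge0_ler_powR ?nnegrE // ler_nat.
rewrite -mulr_sumr ler_wpM2l ?powR_ge0 // exchange_big /=.
apply: (@le_trans _ _ (\sum_(i <- I) ((#|A| ^ E)%:R `^ q * zmax))).
  rewrite big_seq [leRHS]big_seq; apply: ler_sum => i iI.
  have [lv sv jk] := vI i iI; have [h1 h2 h3] := hv _ lv sv.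
  have nj : (n + i.2 <= word_len k i.1)%N.
    by apply: leq_trans h1; rewrite leq_add2l ltnW.
  rewrite /P -partition_fun_tuple //.
  apply: le_trans (@partition_fun_law_map_le _ _ q q_ge0 _ _ (#|A| ^ E)%N _ _) _.
  - exact: law_pos.
  - by move=> u; apply: count_outcomes_window.
  by rewrite ler_wpM2l ?powR_ge0.
rewrite big_const_seq count_predT iter_addr addr0 -[leLHS]mulr_natl.
by rewrite ler_wpM2r ?ler_nat // mulr_ge0 ?powR_ge0.
Qed.

(** A single frequent [v] suffices: each [u] that begins theta^k(v) inherits frequency from it by
    [freq_ge], and truncation to [n] letters merges at most [#|A| ^ E] outcomes. *)
Lemma power_sum_ge k n m E v (zmin : R) : (0 < n)%N ->
  legal th v -> size v = m -> (#|A| ^ m)%:R^-1 <= freq v ->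
  (n <= word_len k v)%N -> (word_len k v <= n + E)%N -> zmin <= Z k v ->
  (#|A| ^ E)%:R^-1 * zmin <=
  (#|A| ^ m * max_len k)%:R `^ q * power_sum n.
Proof.
move=> n0 lv sv hv h1 h2 hz.
have A0 : (0 < #|A|)%N by apply/card_gt0P; exists point.
have AE j : 0 < (#|A| ^ j)%:R :> R by rewrite ltr0n expn_gt0 A0.
have P0 u : 0 <= Pr (window k n 0 v) u by apply: Pr_ge0; apply: window_pos.
rewrite mulrC ler_pdivrMr // [leRHS]mulrC.
apply: le_trans hz _.
apply: le_trans (@partition_fun_law_map_ge _ _ q q_ge0
  (fun x => take n (drop 0 x)) _ (#|A| ^ E)%N _ _) _.
- exact: law_pos.
- by move=> u; apply: count_outcomes_window; rewrite ?addn0.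
rewrite ler_wpM2l // -/(window k n 0 v) partition_fun_tuple ?addn0 //.
rewrite power_sumE // mulr_sumr big_mkcond [leRHS]big_mkcond /=.
apply: ler_sum => u _; case: ifP => lu; last first.
  (* A prefix of an image of the legal word [v] is legal, so other words [u] have probability
     zero. *)
  rewrite (_ : Pr _ _ = 0) ?ppow0 //; apply/eqP; rewrite eq_le P0 andbT leNgt.
  apply: contraFN lu => /= Pu; apply/asboolP.
  move: Pu; rewrite Pr_gt0; last exact: window_pos.
  move=> /mapP[_ /mapP[x xd ->] /= ->]; rewrite drop0.
  apply: legal_infix (infix_take _ _) _; apply: (@legal_image k v) => //.
  exact: map_f.
have sP : Pr (window k n 0 v) u = Ex (law k v) (fun x => (prefix u x)%:R).
  rewrite Pr_law_map; apply: eq_Ex => x _.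
  by rewrite drop0 prefixE size_tuple.
move/asboolP: lu => lu.
have := freq_ge k lu lv; rewrite -sP => hfreq.
have M0 := max_len_gt0 k.
have N0 : 0 < (#|A| ^ m * max_len k)%:R :> R by rewrite natrM mulr_gt0.
have -> : (#|A| ^ m * max_len k)%:R `^ q = ppow q (#|A| ^ m * max_len k)%:R.
  by rewrite /ppow N0.
rewrite -ppowM ?freq_ge0 ?(ltW N0) //; apply: le_ppow => //.
rewrite natrM mulrC -ler_pdivrMr ?mulr_gt0 //; apply: le_trans hfreq.
rewrite invfM mulrA mulrAC ler_wpM2l //.
by rewrite mulr_ge0 // invr_ge0.
Qed.

(** * Exponential growth rate of the power sums *)

Definition phi k : R := - mean (fun a => ln (Z k [:: a])).

(** Taking [m] slightly above [n / lambda ^+ k] makes every image of a legal word of length [m]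
    exceed [n], but only by a small proportion. Both the lengths and the logarithms of Z are sums
    over letters, so [legal_mean] controls them. *)
Lemma typical_lengths k (eta : R) : 0 < eta -> eta <= 1 ->
  exists2 n0, (0 < n0)%N & forall n, (n0 <= n)%N -> exists m E : nat,
    [/\ m%:R <= n%:R / lambda ^+ k + eta * n%:R :> R,
        E%:R <= eta * n%:R :> R &
      forall v, legal th v -> size v = m ->
        [/\ (n + max_len k <= word_len k v)%N, (word_len k v <= n + E)%N &
            `|ln (Z k v) + n%:R * (phi k / lambda ^+ k)| <= eta * n%:R]].
Proof.
move=> eta0 eta1; set Lam := lambda ^+ k.
have Lam1 : 1 <= Lam by rewrite exprn_ege1 // ltW.
have Lam0 : 0 < Lam by apply: lt_le_trans Lam1.
pose K : R := `|phi k|; have K0 : 0 <= K by apply: normr_ge0.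
(* [W] collects the coefficients of the errors proportional to [delta * n], which then use up half
   of [eta * n]; the other half absorbs the rounding of [m]. *)
pose W := 1 + Lam + K; have W0 : 0 < W by rewrite /W; lra.
pose delta := eta / 2 / W.
have dW : delta * W = eta / 2 by rewrite /delta divfK ?gt_eqF.
have d0 : 0 < delta by rewrite !divr_gt0.
have d1 : delta <= 1 by rewrite /delta ler_pdivrMr // mul1r /W; lra.
have e0 : 0 < delta / 6 by rewrite divr_gt0.
have [C1 C10 hC1] := legal_mean (fun a => (iter_len k a)%:R) e0.
have [C2 C20 hC2] := legal_mean (fun a => ln (Z k [:: a])) e0.
pose M : R := (max_len k)%:R; have M0 : 0 <= M by apply: ler0n.
have [N1 _ /(_ N1 (leqnn _)) hN1] := nbhs_infty_gtr ((C1 + C2 + M) / (delta / 2)).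
have [N2 _ /(_ N2 (leqnn _)) hN2] := nbhs_infty_gtr ((Lam + K + 1) / (eta / 2)).
exists (N1 + N2).+1 => // n Nn.
have n1 : 1 <= n%:R :> R by rewrite ler1n; apply: leq_trans Nn.
have nN1 : C1 + C2 + M <= delta / 2 * n%:R.
  rewrite mulrC -ler_pdivrMr ?divr_gt0 // (le_trans (ltW hN1)) // ler_nat.
  exact: leq_trans (leq_addr _ _) (ltnW Nn).
have nN2 : Lam + K + 1 <= eta / 2 * n%:R.
  rewrite mulrC -ler_pdivrMr ?divr_gt0 // (le_trans (ltW hN2)) // ler_nat.
  exact: leq_trans (leq_addl _ _) (ltnW Nn).
clear hN1 hN2 Nn N1 N2.
(* The surplus [delta * n] outweighs the fluctuation of the lengths and the margin [max_len k]. *)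
pose x := n%:R / Lam + delta * n%:R.
have x0 : 0 <= x.
  by apply: addr_ge0; [apply: divr_ge0|apply: mulr_ge0]; rewrite ?ler0n // ltW.
pose m := (Num.trunc x).+1; pose E := Num.trunc (eta * n%:R).
have en0 : 0 <= eta * n%:R by rewrite mulr_ge0 // ltW.
have hm1 : x < m%:R by rewrite /m truncnS_gt.
have hm2 : m%:R <= x + 1 by rewrite /m -natr1 lerD2r truncn_le.
have hdn : delta * n%:R + delta * n%:R * Lam + delta * n%:R * K = eta / 2 * n%:R.
  by rewrite -dW /W; ring.
pose d := delta * n%:R.
have dn0 : 0 <= d by rewrite /d mulr_ge0 // ltW.
have dnn : d <= n%:R by rewrite /d ler_piMl.
have xE : x = n%:R / Lam + d by [].
have nL : n%:R / Lam <= n%:R by rewrite ler_pdivrMr // ler_peMr.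
have nL0 : 0 <= n%:R / Lam by rewrite divr_ge0 ?(ltW Lam0) ?ler0n.
have t0 : d <= d * Lam by rewrite ler_peMr.
have s0 : 0 <= d * K by rewrite mulr_ge0.
rewrite -/d in hdn.
have nN1' : C1 + C2 + M <= d / 2 by rewrite /d mulrAC.
exists m, E; split; [by lra|by rewrite truncn_le|].
move=> v lv sv.
(* The 6 comes from [m <= 3 * n]. *)
have em : delta / 6 * m%:R <= d / 2.
  rewrite (_ : d / 2 = delta / 6 * (3 * n%:R)); last by rewrite /d; field.
  by rewrite ler_pM2l //; lra.
have := hC2 v lv; rewrite sv => h2; have := hC1 v lv; rewrite sv => h1.
have {h1} : `|(word_len k v)%:R - m%:R * Lam| <= d / 2 + C1.
  rewrite /word_len natr_sum /Lam -mean_iter_len; apply: le_trans h1 _.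
  by rewrite lerD2r.
have xL : x * Lam = n%:R + d * Lam by rewrite xE mulrDl divfK // gt_eqF.
have mL1 : n%:R + d * Lam <= m%:R * Lam by rewrite -xL ler_pM2r // ltW.
have mL2 : m%:R * Lam <= n%:R + d * Lam + Lam.
  by rewrite -xL -[X in _ + X]mul1r -mulrDl ler_pM2r.
rewrite ler_norml => /andP[h1a h1b].
split.
- by rewrite -(ler_nat R) natrD -/M; lra.
- have [wn|nw] := leqP (word_len k v) n; first by rewrite (leq_trans wn) ?leq_addr.
  rewrite -leq_subLR /E truncn_ge_nat // natrB ?(ltnW nw) //; lra.
have -> : ln (Z k v) = \sum_(a <- v) ln (Z k [:: a]) by apply: ln_partition_fun_law.
have hphi : `|m%:R * phi k - n%:R * (phi k / Lam)| <= d * K + K.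
  rewrite (_ : _ - _ = (m%:R - n%:R / Lam) * phi k); last by field; rewrite gt_eqF.
  rewrite normrM -/K (_ : d * K + K = (d + 1) * K); last by ring.
  rewrite ler_wpM2r // ger0_norm; lra.
rewrite (_ : _ + _ = (\sum_(a <- v) ln (Z k [:: a]) -
    m%:R * mean (fun a => ln (Z k [:: a]))) -
    (m%:R * phi k - n%:R * (phi k / Lam))); last by rewrite /phi; ring.
apply: le_trans (ler_normB _ _) _.
lra.
Qed.

Lemma ln_card_exp (j : nat) : ln ((#|A| ^ j)%:R : R) = j%:R * ln (#|A|%:R : R).
Proof.
rewrite natrX lnXn ?mulr_natl // ltr0n.
by apply/card_gt0P; exists point.
Qed.

(** Logarithms of the two bounds on [power_sum n]. The factors exponential in [m] leave the error of
    order [lambda ^- k]; all others fit into [eta]. *)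
Lemma power_sum_growth k (eta : R) : 0 < eta ->
  exists n0, forall n, (n0 <= n)%N ->
    `|- (n%:R^-1 * ln (power_sum n)) - phi k / lambda ^+ k| <=
      (1 + q) * ln #|A|%:R / lambda ^+ k + eta.
Proof.
move=> eta0; pose L : R := ln #|A|%:R; rewrite -/L.
have A0 : (0 < #|A|)%N by apply/card_gt0P; exists point.
have AE j : 0 < (#|A| ^ j)%:R :> R by rewrite ltr0n expn_gt0 A0.
have L0 : 0 <= L by rewrite ln_ge0 // ler1n.
have M0 := max_len_gt0 k.
pose l : R := ln (max_len k)%:R.
have l0 : 0 <= l by rewrite ln_ge0 // ler1n -(ltr0n R).
(* The first term pays for the errors [e * n] in [m] and in [E], the constant for [l] and for the
   logarithm of Z. The cap 1 on [e] below is required by [typical_lengths]. *)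
pose W := 2 * (1 + q) * L + 3.
have W0 : 3 <= W by rewrite /W lerDr !mulr_ge0 // addr_ge0.
pose e := Num.min 1 (eta / W).
have e0 : 0 < e by rewrite lt_min ltr01 divr_gt0 //; lra.
have e1 : e <= 1 by rewrite ge_min lexx.
have eW : e * W <= eta by rewrite -ler_pdivlMr ?ge_min ?lexx ?orbT //; lra.
have [n1 n10 hn1] := typical_lengths k e0 e1.
have [n2 _ /(_ n2 (leqnn _)) hn2] := nbhs_infty_gtr ((1 + q) * l / e).
exists (n1 + n2)%N => n nn.
have n1n : (n1 <= n)%N by apply: leq_trans nn; apply: leq_addr.
have n0 : (0 < n)%N by apply: leq_trans n1n.
have nR : 0 < n%:R :> R by rewrite ltr0n.
have ln_n : (1 + q) * l <= e * n%:R.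
  rewrite [leRHS]mulrC -ler_pdivrMr // (le_trans (ltW hn2)) // ler_nat.
  exact: leq_trans (leq_addl _ _) nn.
have [m [E [hm hE hv]]] := hn1 n n1n.
set Lam := lambda ^+ k in hm hv *; set psi := phi k / Lam in hv *.
have NE : ln ((#|A| ^ m * max_len k)%:R : R) = m%:R * L + l.
  by rewrite natrM lnM ?posrE // ln_card_exp.
have N0 : 0 < (#|A| ^ m * max_len k)%:R :> R by rewrite natrM mulr_gt0.
have [v [lv sv fv]] := freq_large m.
have [h1 h2 h3] := hv v lv sv.
have hge : (#|A| ^ E)%:R^-1 * Z k v <=
    (#|A| ^ m * max_len k)%:R `^ q * power_sum n.
  by apply: power_sum_ge sv fv _ h2 (lexx _) => //; apply: leq_trans h1; apply: leq_addr.
have Zv0 : 0 < Z k v by apply: partition_fun_law_gt0.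
have S0 : 0 < power_sum n.
  have : 0 < (#|A| ^ m * max_len k)%:R `^ q * power_sum n.
    by apply: lt_le_trans hge; rewrite mulr_gt0 // invr_gt0.
  by rewrite pmulr_rgt0 // powR_gt0.
pose x := ln (power_sum n).
have lo : - (E%:R * L) + ln (Z k v) <= q * (m%:R * L + l) + x.
  rewrite -NE -ln_powR -lnM ?posrE ?powR_gt0 // -ln_card_exp -lnV ?posrE //.
  by rewrite -lnM ?posrE ?invr_gt0 // ler_ln ?posrE ?mulr_gt0 ?powR_gt0 ?invr_gt0.
have up : x <= q * (m%:R * L + l) + ((m%:R * L + l) +
    (q * (E%:R * L) + (e * n%:R - n%:R * psi))).
  pose zmax := expR (e * n%:R - n%:R * psi).
  have zmax0 : 0 < zmax by apply: expR_gt0.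
  have -> : e * n%:R - n%:R * psi = ln zmax by rewrite expRK.
  rewrite -NE -ln_card_exp -!ln_powR.
  rewrite -!lnM ?posrE ?mulr_gt0 ?powR_gt0 // ler_ln ?posrE ?mulr_gt0 ?powR_gt0 //.
  apply: power_sum_le => //; first exact: ltW.
  move=> w lw sw; have [g1 g2 g3] := hv w lw sw; split=> //.
  rewrite -ler_ln ?posrE ?partition_fun_law_gt0 // expRK.
  by move: g3; rewrite ler_norml => /andP[_]; lra.
have mL : m%:R * L <= (n%:R / Lam + e * n%:R) * L by rewrite ler_wpM2r.
have EL : E%:R * L <= e * n%:R * L by rewrite ler_wpM2r.
have EL0 : 0 <= E%:R * L by rewrite mulr_ge0.
have mL0 : 0 <= m%:R * L by rewrite mulr_ge0.
have Q : (1 + q) * (m%:R * L) + (1 + q) * l + (1 + q) * (E%:R * L) + e * n%:R <=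
    n%:R * ((1 + q) * L / Lam + eta).
  apply: (@le_trans _ _ ((1 + q) * ((n%:R / Lam + e * n%:R) * L) + e * n%:R +
    (1 + q) * (e * n%:R * L) + e * n%:R)).
    have q1 : 0 <= 1 + q by rewrite addr_ge0.
    by rewrite !lerD // ler_wpM2l.
  rewrite mulrDr (_ : _ + _ = n%:R * ((1 + q) * L / Lam) + n%:R * (e * W - e)).
    by rewrite lerD2l ler_wpM2l // (le_trans _ eW) // gerBl ltW.
  by rewrite /W; ring.
have qEL : 0 <= q * (E%:R * L) by rewrite mulr_ge0.
have qmL : 0 <= q * (m%:R * L + l) by rewrite mulr_ge0 // addr_ge0.
rewrite -(ler_pM2l nR) -{1}[n%:R](gtr0_norm nR) -normrM mulrBr mulrN mulrA.
rewrite divff ?gt_eqF // mul1r -/x; apply: le_trans Q.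
move: h3; rewrite !ler_norml => /andP[h3a h3b]; rewrite -/psi.
apply/andP; split; lra.
Qed.

(** First [k] is fixed so large that all errors of order [lambda ^- k] are below half of the
    tolerance, then [n] tends to infinity. *)
Lemma cvg_power_sum (tau : R) :
  (forall k, (0 < k)%N -> `|phi k / lambda ^+ k - tau| <= `|tau| / lambda ^+ k) ->
  (fun n => - (n%:R^-1 * ln (power_sum n)) : R) @ \oo --> tau.
Proof.
move=> htau; apply/cvgrPdist_le => e e0.
have L0 : 0 <= ln #|A|%:R :> R.
  by rewrite ln_ge0 // ler1n; apply/card_gt0P; exists point.
pose D := (1 + q) * ln #|A|%:R + `|tau|.
have D0 : 0 <= D by rewrite /D addr_ge0 // mulr_ge0 // addr_ge0.
have [k0 _ /(_ k0 (leqnn _)) hk0] := nbhs_infty_gtr (D / (e / 2) / (lambda - 1)).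
have lk : D / lambda ^+ k0.+1 <= e / 2.
  have h := lambda_exp_ge k0.+1.
  rewrite ler_pdivrMr ?exprn_gt0 ?lambda_gt0 // -ler_pdivrMl ?divr_gt0 //.
  apply: le_trans h; rewrite -ler_pdivrMr ?subr_gt0 // [_ * D]mulrC.
  by apply: le_trans (ltW hk0) _; rewrite ler_nat.
have [|N hN] := @power_sum_growth k0.+1 (e / 2); first by rewrite divr_gt0.
exists N => // n /= Nn; have := hN n Nn; have := htau k0.+1 isT.
set a := phi _ / _; set b := - (_ * _) => h1 h2.
rewrite distrC (_ : b - tau = (b - a) + (a - tau)); last by ring.
apply: le_trans (ler_normD _ _) _.
apply: le_trans (lerD h2 h1) _.
rewrite /D mulrDl in lk; lra.
Qed.

(** * Recursions for phi *)

Lemma phi_sum (F : A -> R) :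
  \sum_a r a * (\sum_b (iter_count 1 a b)%:R * F b) = lambda * mean F.
Proof.
under eq_bigr do rewrite mulr_sumr.
rewrite exchange_big /= /mean mulr_sumr; apply: eq_bigr => b _.
rewrite mulrA -[lambda]expr1 -r_eigen mulr_suml; apply: eq_bigr => a _.
by rewrite mulrCA mulrA.
Qed.

(** The recursion sums to phi_k = phi_1 (lambda^k - 1) / (lambda - 1), so the relative error is
    exactly [lambda ^- k], as [cvg_power_sum] allows. *)
Lemma phi_disjoint k : disjoint_set_condition th -> (0 < k)%N ->
  phi k / lambda ^+ k - (lambda - 1)^-1 * phi 1 =
  - ((lambda - 1)^-1 * phi 1) / lambda ^+ k.
Proof.
move=> disj; case: k => // k _; have l0 := lambda_gt0.
have lneq : lambda != 0 by rewrite gt_eqF.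
have l1neq : lambda - 1 != 0 by rewrite gt_eqF // subr_gt0.
have lk n : lambda ^+ n != 0 by rewrite expf_neq0.
suff h : phi k.+1 = (lambda - 1)^-1 * phi 1 * (lambda ^+ k.+1 - 1).
  by rewrite h; field; rewrite lk l1neq.
elim: k => [|k IH]; first by rewrite expr1; field.
have -> : phi k.+2 = phi 1 + lambda * phi k.+1.
  rewrite /phi mulrN -opprD -phi_sum /mean -big_split; congr (- _).
  by apply: eq_bigr => a _; rewrite ln_partition_fun_disjoint // mulrDr.
by rewrite IH [lambda ^+ k.+2]exprS; field.
Qed.

Lemma phi_identical k : identical_production_probabilities th -> (0 < k)%N ->
  phi k / lambda ^+ k = lambda^-1 * phi 1.
Proof.
move=> ident; case: k => // k _; have l0 := lambda_gt0.
have lneq : lambda != 0 by rewrite gt_eqF.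
have lk n : lambda ^+ n != 0 by rewrite expf_neq0.
elim: k => [|k IH]; first by rewrite expr1 mulrC.
have -> : phi k.+2 = lambda * phi k.+1.
  rewrite /phi mulrN -phi_sum /mean; congr (- _).
  by apply: eq_bigr => a _; rewrite ln_partition_fun_identical.
by rewrite -IH [lambda ^+ k.+2]exprS; field; rewrite lneq lk.
Qed.

End Frequencies.

(** * From abstract frequencies to the spectrum of the measure *)

Lemma perron_eigenvalue_le (R : realType) n (M : 'M[R]_n) (l1 l2 : R) :
  0 <= l1 -> eigenvalue M l1 -> perron_eigenvalue M l2 -> l1 <= l2.
Proof.
move=> l10 ev [_ /(_ (real_complex R l1))].
(* Roots of the characteristic polynomial carry a real eigenvalue over to the complex matrix. *)
rewrite eigenvalue_root_char -map_char_poly fmorph_root -eigenvalue_root_char.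
by move=> /(_ ev); rewrite ger0_norm lecR.
Qed.

Lemma cvg_EFin_limn_einf (R : realType) (u : R^nat) (l : R) :
  u @ \oo --> l -> limn_einf (fun n => (u n)%:E) = l%:E.
Proof.
move=> ul; apply: (cvg_limn_einf_sup _).1.
by apply/fine_cvgP; split; [exact: nearW|exact: ul].
Qed.

Theorem corollaryB (R : realType) (A : alphabetType)
    (th : random_substitution R A) (lambda : R) (r : 'cV[R]_#|A|)
    (mu : probability (bi_infinite_borel A) R) :
  primitive_subst th -> compatible_subst th ->
  perron_eigenvalue (subst_mx th) lambda ->
  perron_vector (subst_mx th) lambda r ->
  frequency_measure th mu ->
  forall q : R, 0 <= q ->
    (disjoint_set_condition th ->
       Lq_spectrum th mu q = ((lambda - 1)^-1 * phi1 th r q)%:E) /\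
    (identical_set_condition th -> identical_production_probabilities th ->
       Lq_spectrum th mu q = (lambda^-1 * phi1 th r q)%:E).
Proof.
move=> prim compat perron rP [_ _ freqP] q q0.
(* Primitivity provides some eigenvalue above 1, and [lambda] dominates it. *)
have lambda_gt1 : 1 < lambda.
  have [_ [l [ev _] l1]] := prim; apply: (lt_le_trans l1).
  by apply: perron_eigenvalue_le ev perron; apply: le_trans (ltW l1).
pose ra a := r (enum_rank a) 0.
have [_ r_gt0 r_sum] := rP.
have ra_gt0 a : 0 < ra a by apply: r_gt0.
have ra_sum : \sum_a ra a = 1.
  rewrite -r_sum -sum_enum_val; apply: eq_bigr => i _.
  by rewrite /ra enum_valK.
have ra_eigen k b :
    \sum_a (iter_count th k a b)%:R * ra a = lambda ^+ k * ra b.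
  exact: perron_vector_iter.
have phi1E : phi1 th r q = phi th ra q 1.
  congr (- _); apply: eq_bigr => a _.
  by rewrite partition_fun_law1.
have l1 : 0 < lambda - 1 by rewrite subr_gt0.
have l0 : 0 < lambda by apply: lt_trans lambda_gt1.
pose freq v := fine (mu (cylinder th v)).
have cvg tau := @cvg_power_sum _ _ _ compat prim _ _ lambda_gt1 ra_gt0 ra_sum
  ra_eigen freq freqP q q0 tau.
split=> [disj|_ ident].
  apply: cvg_EFin_limn_einf; apply: cvg => k k0.
  rewrite phi1E (phi_disjoint compat) // normrM normrN normfV.
  by rewrite [X in _ / X]gtr0_norm // exprn_gt0.
apply: cvg_EFin_limn_einf; apply: cvg => k k0.
rewrite phi1E (phi_identical compat) // subrr normr0.
by rewrite divr_ge0 // exprn_ge0 // ltW.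
Qed.
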